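(* The algebra $D(R_A)$ is simple if and only if the semigroup $\mathbb NA$ is scored and, for every $\boldsymbol\alpha\in\mathbb C^d$, the set $\mathbb R_{>0}(\boldsymbol\alpha)$ is nonempty.
   Context: $A\subset\mathbb Z^d$ is a finite set generating the group $\mathbb Z^d$; $\mathbb NA$ its monoid; $R_A=\mathbb C[\mathbb NA]\subseteq\mathbb C[t_1^{\pm1},\dots,t_d^{\pm1}]$; $D(R_A)=\{P\in\mathbb C[t^{\pm1}]\langle\partial_1,\dots,\partial_d\rangle:P(R_A)\subseteq R_A\}$; simple means no two-sided ideals other than $0$ and $D(R_A)$. For a facet $\sigma$ of the cone $\mathbb R_{\ge0}A$, $F_\sigma$ is the unique linear form (extended $\mathbb C$-linearly) with $F_\sigma(\mathbb R_{\ge0}A)\ge0$, $F_\sigma(\sigma)=0$, $F_\sigma(\mathbb Z^d)=\mathbb Z$. $\mathbb NA$ is scored if $\mathbb NA=\bigcap_{\sigma\text{ facet}}\{\mathbf a\in\mathbb Z^d:F_\sigma(\mathbf a)\in F_\sigma(\mathbb NA)\}$. $\mathcal F_+(\boldsymbol\alpha)=\{\sigma:F_\sigma(\boldsymbol\alpha)\in F_\sigma(\mathbb NA)\}$, $\mathcal F_-(\boldsymbol\alpha)=\{\sigma:F_\sigma(\boldsymbol\alpha)\in\mathbb Z\setminus F_\sigma(\mathbb NA)\}$, $\mathbb R_{>0}(\boldsymbol\alpha)=\{\boldsymbol\gamma\in\mathbb R^d:F_\sigma(\boldsymbol\gamma)>0\ (\sigma\in\mathcal F_+(\boldsymbol\alpha)),\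 F_\sigma(\boldsymbol\gamma)<0\ (\sigma\in\mathcal F_-(\boldsymbol\alpha))\}$. *)

(* Defs.v *)
From HB Require Import structures.
From mathcomp Require Import all_boot all_order all_algebra.
From mathcomp Require Import complex Rstruct.
Set Implicit Arguments. Unset Strict Implicit. Unset Printing Implicit Defensive.
Import Order.TTheory GRing.Theory Num.Theory.
Local Open Scope ring_scope.

Definition RR : rcfType := Rdefinitions.R.
Definition CC := complex RR.

Definition Zd (d : nat) := 'rV[int]_d.

Definition generates_group (d : nat) (A : seq (Zd d)) : Prop :=
  forall m : Zd d, exists k : 'I_(size A) -> int,
    m = \sum_(i < size A) (A`_i *~ k i).

Definition inNA (d : nat) (A : seq (Zd d)) (m : Zd d) : Prop :=
  exists k : 'I_(size A) -> nat, m = \sum_(i < size A) (A`_i *+ k i).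

Definition evZ (d : nat) (F : Zd d) (m : Zd d) : int :=
  \sum_(i < d) F 0 i * m 0 i.
Definition evC (d : nat) (F : Zd d) (al : 'rV[CC]_d) : CC :=
  \sum_(i < d) (F 0 i)%:~R * al 0 i.
Definition evR (d : nat) (F : Zd d) (g : 'rV[RR]_d) : RR :=
  \sum_(i < d) (F 0 i)%:~R * g 0 i.

Definition toQ (d : nat) (v : Zd d) : 'rV[rat]_d := map_mx (fun x : int => x%:~R) v.

(* F is the primitive inward normal form F_sigma of a facet sigma of the cone
   R_{>=0} A: F >= 0 on A (hence on the cone), F(Z^d) = Z, and the face
   sigma = cone ∩ ker F (the cone spanned by the elements of A killed by F)
   has dimension d-1. Facets correspond bijectively to such forms. *)
Definition facet_form (d : nat) (A : seq (Zd d)) (F : Zd d) : Prop :=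
  [/\ (forall a, a \in A -> 0 <= evZ F a),
      (forall z : int, exists m : Zd d, evZ F m = z) &
      exists s : seq (Zd d),
        (forall a, a \in s -> (a \in A) /\ evZ F a = 0) /\
        \rank (\matrix_(j < size s) toQ (s`_j)) = d.-1 ].

Definition scored (d : nat) (A : seq (Zd d)) : Prop :=
  forall m : Zd d,
    inNA A m <-> (forall F, facet_form A F -> exists b, inNA A b /\ evZ F b = evZ F m).

Definition in_Fplus (d : nat) (A : seq (Zd d)) (al : 'rV[CC]_d) (F : Zd d) : Prop :=
  exists b, inNA A b /\ evC F al = (evZ F b)%:~R.
Definition in_Fminus (d : nat) (A : seq (Zd d)) (al : 'rV[CC]_d) (F : Zd d) : Prop :=
  (exists z : int, evC F al = z%:~R) /\ ~ in_Fplus A al F.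

Definition Rpos_nonempty (d : nat) (A : seq (Zd d)) (al : 'rV[CC]_d) : Prop :=
  exists g : 'rV[RR]_d, forall F, facet_form A F ->
    (in_Fplus A al F -> 0 < evR F g) /\ (in_Fminus A al F -> evR F g < 0).

(* A Laurent polynomial f = sum_m f(m) t^m in C[t^{±1}] is encoded by its
   coefficient function; operators act on coefficient functions. *)
Definition coeffs (d : nat) := Zd d -> CC.
Definition op (d : nat) := coeffs d -> coeffs d.

Definition finsupp (d : nat) (f : coeffs d) : Prop :=
  exists s : seq (Zd d), forall n, f n != 0 -> n \in s.

Definition in_RA (d : nat) (A : seq (Zd d)) (f : coeffs d) : Prop :=
  finsupp f /\ forall n, f n != 0 -> inNA A n.

Definition ffactC (m : int) (k : nat) : CC := \prod_(j < k) (m - j%:Z)%:~R.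

(* the monomial operator c * t^a * d^beta :
   t^a d^beta t^m = (m)_beta t^(m - beta + a) *)
Definition mono_op (d : nat) (c : CC) (a : Zd d) (be : 'rV[nat]_d) : op d :=
  fun f n =>
    let m := n - a + map_mx (fun k : nat => k%:Z) be in
    c * (\prod_(i < d) ffactC (m 0 i) (be 0 i)) * f m.

(* elements of the ring C[t^{±1}]<d_1,...,d_d> (acting faithfully) *)
Definition weyl_op (d : nat) (s : seq (CC * Zd d * 'rV[nat]_d)) : op d :=
  fun f n => \sum_(x <- s) mono_op x.1.1 x.1.2 x.2 f n.

Definition is_weyl (d : nat) (P : op d) : Prop := exists s, P = weyl_op s.

Definition in_DRA (d : nat) (A : seq (Zd d)) (P : op d) : Prop :=
  is_weyl P /\ forall f, in_RA A f -> in_RA A (P f).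

Definition op0 (d : nat) : op d := fun _ _ => 0.
Definition opB (d : nat) (P Q : op d) : op d := fun f n => P f n - Q f n.
Definition opM (d : nat) (P Q : op d) : op d := fun f => P (Q f).

Definition two_sided_ideal (d : nat) (A : seq (Zd d)) (I : op d -> Prop) : Prop :=
  [/\ (forall P, I P -> in_DRA A P),
      I (@op0 d),
      (forall P Q, I P -> I Q -> I (opB P Q)) &
      (forall P Q, in_DRA A P -> I Q -> I (opM P Q) /\ I (opM Q P)) ].

Definition DRA_simple (d : nat) (A : seq (Zd d)) : Prop :=
  forall I, two_sided_ideal A I ->
    (forall P, I P <-> P = @op0 d) \/ (forall P, I P <-> in_DRA A P).

(* Main.v *)
Require Import Defs.
From HB Require Import structures.
From mathcomp Require Import all_boot all_order all_algebra.
From mathcomp Require Import complex Rstruct boolp zify ring.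
Set Implicit Arguments. Unset Strict Implicit. Unset Printing Implicit Defensive.
Import Order.TTheory GRing.Theory Num.Theory.
Local Open Scope ring_scope.

(* D(R_A) is graded by Z^d: an operator is a finite sum of terms t^a p(theta), where
   theta_i = t_i d_i and p is a polynomial function on C^d, and it preserves R_A iff each
   p vanishes at the m in NA with m + a not in NA.

   If D(R_A) is simple, every nonzero subquotient of a module C[t^{±1}] t^alpha is faithful.
   Symbols of D(R_A) never lead out of the set of weights x with F(x) in F(NA), F a facet
   form. Hence the scored closure of NA modulo NA spans a subquotient; it is annihilated by
   t^b for b in the conductor of NA, so it is zero and NA is scored. Likewise the weights
   x in alpha + Z^d with F_+(x) = F_+(alpha) span a nonzero subquotient; if R_{>0}(alpha) is
   empty, Gordan's alternative confines these weights to finitely many hyperplanes, and a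
   product of affine forms annihilates it.

   Conversely, commutators with the theta_i and with monomials of R_A bring a nonzero ideal
   down to some t^b. For NA scored there are operators t^a p_a(theta) in D(R_A) with p_a a
   product of affine forms; if R_{>0}(alpha) is nonempty, moving far along v in it, the
   products p_{-b-v}(theta + b + v) p_v(theta) of degree 0 lie in the ideal and one of them
   does not vanish at alpha. Having no common zero, they generate 1. *)

(** * Polynomial functions *)

Lemma lincomb_cons (K : pzRingType) (V : lmodType K) (c : nat -> K) (a : V) (s : seq V) :
  \sum_(i < size (a :: s)) c i *: (a :: s)`_i
  = c 0%N *: a + \sum_(i < size s) c i.+1 *: s`_i.
Proof. by rewrite big_ord_recl. Qed.

(** Polynomials are kept as functions, since they occur as symbols evaluated at weights. The index
    is only an upper bound for the degree; it drives the induction by differences. *)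
Inductive pdeg (K : fieldType) (d : nat) : nat -> ('rV[K]_d -> K) -> Prop :=
| pdeg_const n c : pdeg n (fun=> c)
| pdeg_coord n i : pdeg n.+1 (fun x => x 0 i)
| pdeg_add n p q : pdeg n p -> pdeg n q -> pdeg n (fun x => p x + q x)
| pdeg_mul m n p q : pdeg m p -> pdeg n q -> pdeg (m + n) (fun x => p x * q x).

Lemma pdeg_le (K : fieldType) d n (p : 'rV[K]_d -> K) :
  pdeg n p -> forall m, (n <= m)%N -> pdeg m p.
Proof.
elim=> {n p} [n c|n i|n p q _ IHp _ IHq|m n p q _ IHp _ IHq] k lek.
- exact: pdeg_const.
- by case: k lek => // k _; exact: pdeg_coord.
- by apply: pdeg_add; [exact: IHp|exact: IHq].
have -> : k = (m + (k - m))%N by lia.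
by apply: pdeg_mul; [exact: IHp|apply: IHq; lia].
Qed.

Definition polyfun (K : fieldType) (d : nat) (p : 'rV[K]_d -> K) := exists n, pdeg n p.

Lemma polyfunC (K : fieldType) d c : polyfun (fun _ : 'rV[K]_d => c).
Proof. by exists 0%N; exact: pdeg_const. Qed.

Lemma polyfunX (K : fieldType) d i : polyfun (fun x : 'rV[K]_d => x 0 i).
Proof. by exists 1%N; exact: pdeg_coord. Qed.

Lemma polyfunD (K : fieldType) d (p q : 'rV[K]_d -> K) :
  polyfun p -> polyfun q -> polyfun (fun x => p x + q x).
Proof.
move=> [m hp] [n hq]; exists (m + n)%N.
by apply: pdeg_add; [apply: (pdeg_le hp); lia|apply: (pdeg_le hq); lia].
Qed.

Lemma polyfunM (K : fieldType) d (p q : 'rV[K]_d -> K) :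
  polyfun p -> polyfun q -> polyfun (fun x => p x * q x).
Proof. by move=> [m hp] [n hq]; exists (m + n)%N; exact: pdeg_mul. Qed.

Lemma polyfun_ext (K : fieldType) d (p q : 'rV[K]_d -> K) : p =1 q -> polyfun p -> polyfun q.
Proof. by move=> /funext ->. Qed.

Lemma polyfunZ (K : fieldType) d c (p : 'rV[K]_d -> K) :
  polyfun p -> polyfun (fun x => c * p x).
Proof. by move=> hp; apply: polyfunM => //; exact: polyfunC. Qed.

Lemma polyfunN (K : fieldType) d (p : 'rV[K]_d -> K) : polyfun p -> polyfun (fun x => - p x).
Proof.
by move=> hp; apply: polyfun_ext (polyfunZ (-1) hp) => x; rewrite mulN1r.
Qed.

Lemma polyfunB (K : fieldType) d (p q : 'rV[K]_d -> K) :
  polyfun p -> polyfun q -> polyfun (fun x => p x - q x).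
Proof. by move=> hp hq; apply: polyfunD => //; exact: polyfunN. Qed.

Lemma polyfun_sum (K : fieldType) d (I : Type) (s : seq I) (P : pred I)
    (F : I -> 'rV[K]_d -> K) :
  (forall i, polyfun (F i)) -> polyfun (fun x => \sum_(i <- s | P i) F i x).
Proof.
move=> hF; elim: s => [|i s IH].
  by apply: polyfun_ext (polyfunC _ 0) => x; rewrite big_nil.
case Pi: (P i).
  by apply: polyfun_ext (polyfunD (hF i) IH) => x; rewrite big_cons Pi.
by apply: polyfun_ext IH => x; rewrite big_cons Pi.
Qed.

Lemma polyfun_prod (K : fieldType) d (I : Type) (s : seq I) (P : pred I)
    (F : I -> 'rV[K]_d -> K) :
  (forall i, polyfun (F i)) -> polyfun (fun x => \prod_(i <- s | P i) F i x).
Proof.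
move=> hF; elim: s => [|i s IH].
  by apply: polyfun_ext (polyfunC _ 1) => x; rewrite big_nil.
case Pi: (P i).
  by apply: polyfun_ext (polyfunM (hF i) IH) => x; rewrite big_cons Pi.
by apply: polyfun_ext IH => x; rewrite big_cons Pi.
Qed.

Lemma pdeg_shift (K : fieldType) d n (p : 'rV[K]_d -> K) v :
  pdeg n p -> pdeg n (fun x => p (x + v)).
Proof.
elim=> {n p} [n c|n i|n p q _ IHp _ IHq|m n p q _ IHp _ IHq].
- exact: pdeg_const.
- have -> : (fun x : 'rV_d => (x + v) 0 i) = (fun x => x 0 i + v 0 i).
    by apply/funext => x; rewrite mxE.
  by apply: pdeg_add; [exact: pdeg_coord|exact: pdeg_const].
- exact: (pdeg_add IHp IHq).
- exact: (pdeg_mul IHp IHq).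
Qed.

Lemma polyfun_shift (K : fieldType) d (p : 'rV[K]_d -> K) v :
  polyfun p -> polyfun (fun x => p (x + v)).
Proof. by move=> [n hp]; exists n; exact: pdeg_shift. Qed.

(** Shifting fixes the leading terms, so a difference lowers the bound. Bound 0 is stated apart:
    there the difference vanishes. *)
Lemma pdeg_diff (K : fieldType) d n (p : 'rV[K]_d -> K) v :
  pdeg n p ->
  if n is k.+1 then pdeg k (fun x => p (x + v) - p x) else forall x, p (x + v) - p x = 0.
Proof.
elim=> {n p} [n c|n i|n p q _ IHp _ IHq|m n p q hp IHp hq IHq].
- by case: n => [x|n]; rewrite ?subrr //; exact: pdeg_const.
- have -> : (fun x : 'rV_d => (x + v) 0 i - x 0 i) = (fun=> v 0 i).
    by apply/funext => x; rewrite mxE addrC addKr.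
  exact: pdeg_const.
- case: n IHp IHq => [|n] IHp IHq.
    by move=> x; rewrite opprD addrACA IHp IHq addr0.
  have -> : (fun x => p (x + v) + q (x + v) - (p x + q x)) =
            (fun x => (p (x + v) - p x) + (q (x + v) - q x)).
    by apply/funext => x; rewrite opprD addrACA.
  exact: pdeg_add.
(* Discrete Leibniz rule. *)
have E : (fun x => p (x + v) * q (x + v) - p x * q x) =
         (fun x => (p (x + v) - p x) * q (x + v) + p x * (q (x + v) - q x)).
  by apply/funext => x; ring.
case: m n hp hq IHp IHq => [|m] [|n] hp hq IHp IHq.
- by move=> x; move: (congr1 (fun f => f x) E) => /= ->; rewrite IHp IHq mul0r mulr0 addr0.
- have -> : (fun x => p (x + v) * q (x + v) - p x * q x) =
            (fun x => p x * (q (x + v) - q x)).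
    by rewrite E; apply/funext => x; rewrite IHp mul0r add0r.
  exact: (pdeg_mul hp IHq).
- have -> : (fun x => p (x + v) * q (x + v) - p x * q x) =
            (fun x => (p (x + v) - p x) * q (x + v)).
    by rewrite E; apply/funext => x; rewrite IHq mulr0 addr0.
  exact: (pdeg_mul IHp (pdeg_shift v hq)).
rewrite /= E; apply: pdeg_add.
  exact: (pdeg_mul IHp (pdeg_shift v hq)).
by rewrite addnS -addSn; exact: pdeg_mul.
Qed.

Lemma polyfun_line (K : fieldType) d (p : 'rV[K]_d -> K) x v :
  polyfun p -> exists q : {poly K}, forall z, p (x + z *: v) = q.[z].
Proof.
case=> n; elim=> {n p} [n c|n i|n p q _ [P hP] _ [Q hQ]|m n p q _ [P hP] _ [Q hQ]].
- by exists c%:P => z; rewrite hornerC.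
- by exists ((x 0 i)%:P + (v 0 i)%:P * 'X) => z; rewrite !hornerE !mxE mulrC.
- by exists (P + Q) => z; rewrite hornerD hP hQ.
- by exists (P * Q) => z; rewrite hornerM hP hQ.
Qed.

Lemma poly_nat_zero (K : numFieldType) (q : {poly K}) : (forall n : nat, q.[n%:R] = 0) -> q = 0.
Proof.
move=> hq; apply/eqP; apply: contraT => q0.
have := max_poly_roots (rs := [seq (i%:R : K) | i <- iota 0 (size q)]) q0.
rewrite size_map size_iota ltnn => -> //.
  by apply/allP => _ /mapP [i _ ->]; rewrite /root hq.
by rewrite map_inj_uniq ?iota_uniq // => i j /eqP; rewrite eqr_nat => /eqP.
Qed.

Definition iotaZ (K : pzRingType) (d : nat) (m : 'rV[int]_d) : 'rV[K]_d :=
  map_mx (fun z : int => z%:~R) m.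
Arguments iotaZ {K d}.

Lemma iotaZD (K : pzRingType) d (a b : 'rV[int]_d) : iotaZ (a + b) = iotaZ a + iotaZ b :> 'rV[K]_d.
Proof. by apply/rowP => i; rewrite !mxE intrD. Qed.
Lemma iotaZN (K : pzRingType) d (a : 'rV[int]_d) : iotaZ (- a) = - iotaZ a :> 'rV[K]_d.
Proof. by apply/rowP => i; rewrite !mxE intrN. Qed.
Lemma iotaZB (K : pzRingType) d (a b : 'rV[int]_d) : iotaZ (a - b) = iotaZ a - iotaZ b :> 'rV[K]_d.
Proof. by rewrite iotaZD iotaZN. Qed.
Lemma iotaZ0 (K : pzRingType) d : iotaZ 0 = 0 :> 'rV[K]_d.
Proof. by apply/rowP => i; rewrite !mxE. Qed.
Lemma iotaZMz (K : pzRingType) d (a : 'rV[int]_d) z : iotaZ (a *~ z) = z%:~R *: iotaZ a :> 'rV[K]_d.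
Proof. by rewrite -(scaler_int z a); apply/rowP => i; rewrite !mxE -intrM intz. Qed.
Lemma iotaZ_sum (K : pzRingType) d (I : Type) (s : seq I) (F : I -> 'rV[int]_d) :
  iotaZ (\sum_(i <- s) F i) = \sum_(i <- s) iotaZ (F i) :> 'rV[K]_d.
Proof.
by elim: s => [|i s IH]; rewrite ?big_nil ?iotaZ0 // !big_cons iotaZD IH.
Qed.

(* One direction at a time, a polynomial in one variable vanishing on the naturals is zero. *)
Lemma polyfun_vanish (K : numFieldType) d (s : seq 'rV[K]_d) (p : 'rV[K]_d -> K)
    (T : 'rV[K]_d -> Prop) :
  polyfun p -> (forall x a, T x -> a \in s -> T (x + a)) ->
  (forall x, T x -> p x = 0) ->
  forall x (u : nat -> K), T x -> p (x + \sum_(i < size s) u i *: s`_i) = 0.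
Proof.
move=> hp; elim: s T => [|a s IH] T hT h0 x u Tx.
  by rewrite big_ord0 addr0; exact: h0.
rewrite lincomb_cons addrA.
(* [T'] is the union of the lines through [T] in direction [a]; [p] vanishes on each, since all
   natural multiples of [a] stay in [T]. *)
pose T' y := exists x z, T x /\ y = x + z *: a.
apply: (IH T' _ _ _ (fun i => u i.+1)).
- move=> _ b [y [z [Ty ->]]] bs; exists (y + b), z; split.
    by apply: hT => //; rewrite inE bs orbT.
  by rewrite addrAC.
- move=> _ [y [z [Ty ->]]]; have [q hq] := polyfun_line y a hp.
  rewrite hq; suff -> : q = 0 by rewrite horner0.
  apply: poly_nat_zero => n; rewrite -hq; apply: h0.
  elim: n => [|n IHn]; first by rewrite scale0r addr0.
  by rewrite -natr1 scalerDl scale1r addrA; apply: hT => //; rewrite inE eqxx.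
by exists x, (u 0%N).
Qed.

(** * Operators and their symbols *)

Record pfun (d : nat) := PFun { pfun_fun :> 'rV[CC]_d -> CC; pfunP : polyfun pfun_fun }.

(** The operator [t^a p(theta)]: it maps [t^m] to [p(m) t^(m + a)], so the coefficient at [n] comes
    from [m = n - a]. *)
Definition mon (d : nat) (a : Zd d) (p : 'rV[CC]_d -> CC) : op d :=
  fun f n => p (iotaZ (n - a)) * f (n - a).

Definition opL (d : nat) (L : seq (Zd d * pfun d)) : op d :=
  fun f n => \sum_(y <- L) mon y.1 y.2 f n.

(** A list may repeat a degree; the symbol of degree [a] collects all its terms. *)
Definition symL (d : nat) (L : seq (Zd d * pfun d)) (a : Zd d) (x : 'rV[CC]_d) : CC :=
  \sum_(y <- L | y.1 == a) y.2 x.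

Lemma polyfun_symL d (L : seq (Zd d * pfun d)) a : polyfun (symL L a).
Proof. by apply: polyfun_sum => y; exact: pfunP. Qed.

Lemma sum_collect_on d (L : seq (Zd d * pfun d)) (U : seq (Zd d)) (H : Zd d -> CC)
    (Y : Zd d -> 'rV[CC]_d) :
  uniq U -> {subset unzip1 L <= U} ->
  \sum_(y <- L) H y.1 * y.2 (Y y.1) = \sum_(a <- U) H a * symL L a (Y a).
Proof.
move=> uU; elim: L => [|y L IH] sub.
  by rewrite big_nil big1 // => a _; rewrite /symL big_nil mulr0.
have yU : y.1 \in U by apply: sub; rewrite inE eqxx.
rewrite big_cons IH; last by move=> a ha; apply: sub; rewrite inE ha orbT.
rewrite [in RHS](bigD1_seq y.1) //= [in LHS](bigD1_seq y.1) //= addrA; congr (_ + _).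
  by rewrite /symL big_cons eqxx -mulrDr.
by apply: eq_bigr => a ya; rewrite /symL big_cons eq_sym (negbTE ya).
Qed.

Lemma sum_collect d (L : seq (Zd d * pfun d)) (H : Zd d -> CC) (Y : Zd d -> 'rV[CC]_d) :
  \sum_(y <- L) H y.1 * y.2 (Y y.1) =
  \sum_(a <- undup (unzip1 L)) H a * symL L a (Y a).
Proof.
by apply: sum_collect_on; [exact: undup_uniq|move=> a; rewrite mem_undup].
Qed.

Lemma opL_symL d (L : seq (Zd d * pfun d)) f n :
  opL L f n = \sum_(a <- undup (unzip1 L)) symL L a (iotaZ (n - a)) * f (n - a).
Proof.
under [RHS]eq_bigr => a _ do rewrite mulrC.
rewrite -(sum_collect L (fun a => f (n - a)) (fun a => iotaZ (n - a))).
by apply: eq_bigr => y _; rewrite /mon mulrC.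
Qed.

Definition delta (d : nat) (m : Zd d) : coeffs d := fun n => (n == m)%:R.

(** Symbols are the matrix coefficients between monomials; this links the action on R_A to
    symbols. *)
Lemma opL_delta d (L : seq (Zd d * pfun d)) m a : opL L (delta m) (m + a) = symL L a (iotaZ m).
Proof.
rewrite /opL /symL [RHS]big_mkcond; apply: eq_bigr => y _.
rewrite /mon /delta; case: (y.1 =P a) => [->|ne]; first by rewrite addrK eqxx mulr1.
case: eqP => [e|]; last by rewrite mulr0.
by case: ne; apply: (addrI m); rewrite -{1}e subrK.
Qed.

Definition monP (d : nat) (a : Zd d) (p : 'rV[CC]_d -> CC) (hp : polyfun p) := [:: (a, PFun hp)].

Lemma opL_monP d (a : Zd d) p (hp : polyfun p) : opL (monP a hp) = mon a p.
Proof. by apply/funext => f; apply/funext => n; rewrite /opL big_seq1. Qed.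

Definition pfunN (d : nat) (p : pfun d) : pfun d := PFun (polyfunN (pfunP p)).
Definition pfun_comp (d : nat) (p q : pfun d) (v : 'rV[CC]_d) : pfun d :=
  PFun (polyfunM (polyfun_shift v (pfunP p)) (pfunP q)).

Definition subL (d : nat) (L M : seq (Zd d * pfun d)) :=
  L ++ [seq (y.1, pfunN y.2) | y <- M].

Lemma opL_sub d (L M : seq (Zd d * pfun d)) : opL (subL L M) = opB (opL L) (opL M).
Proof.
apply/funext => f; apply/funext => n; rewrite /opB /opL big_cat big_map -sumrN.
by congr (_ + _); apply: eq_bigr => y _; rewrite /mon mulNr.
Qed.

Lemma symL_sub d (L M : seq (Zd d * pfun d)) a x : symL (subL L M) a x = symL L a x - symL M a x.
Proof. by rewrite /symL big_cat big_map /= -sumrN. Qed.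

Definition mulL (d : nat) (L M : seq (Zd d * pfun d)) :=
  [seq (y.1 + z.1, pfun_comp y.2 z.2 (iotaZ z.1)) | y <- L, z <- M].

(** The commutation rule [p(theta) t^b = t^b p(theta + b)]. *)
Lemma opM_mon d (a b : Zd d) (p q : 'rV[CC]_d -> CC) :
  opM (mon a p) (mon b q) = mon (a + b) (fun x => p (x + iotaZ b) * q x).
Proof.
apply/funext => f; apply/funext => n; rewrite /opM /mon opprD !addrA mulrA.
by rewrite -iotaZD subrK.
Qed.

Lemma opL_mul d (L M : seq (Zd d * pfun d)) : opL (mulL L M) = opM (opL L) (opL M).
Proof.
apply/funext => f; apply/funext => n; rewrite /opM /opL /mulL.
rewrite big_allpairs_dep /=; apply: eq_bigr => y _.
rewrite /mon mulr_sumr; apply: eq_bigr => z _.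
exact: (congr1 (fun P => P f n) (esym (opM_mon y.1 z.1 y.2 z.2))).
Qed.

Lemma symL_mul d (L M : seq (Zd d * pfun d)) c x :
  symL (mulL L M) c x =
  \sum_(b <- undup (unzip1 M)) symL L (c - b) (x + iotaZ b) * symL M b x.
Proof.
rewrite -(sum_collect M (fun b => symL L (c - b) (x + iotaZ b)) (fun=> x)).
rewrite /symL big_mkcond /mulL big_allpairs_dep /= exchange_big /=.
apply: eq_bigr => z _; rewrite mulr_suml [in RHS]big_mkcond /=.
by apply: eq_bigr => y _; rewrite [in RHS]eq_sym subr_eq eq_sym.
Qed.

Definition ffact (K : pzRingType) (z : K) (k : nat) : K := \prod_(j < k) (z - j%:R).

(** The product of falling factorials is the symbol of [t^beta d^beta], so this span consists of
    symbols of Weyl operators of degree 0. *)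
Definition ffspan (d : nat) (q : 'rV[CC]_d -> CC) := exists s : seq (CC * 'rV[nat]_d),
  q = fun x => \sum_(y <- s) y.1 * \prod_(i < d) ffact (x 0 i) (y.2 0 i).

Lemma ffspanD d (p q : 'rV[CC]_d -> CC) :
  ffspan p -> ffspan q -> ffspan (fun x => p x + q x).
Proof.
by move=> [s ->] [t ->]; exists (s ++ t); apply/funext => x; rewrite big_cat.
Qed.

Lemma ffspan1 d c (be : 'rV[nat]_d) :
  ffspan (fun x => c * \prod_(i < d) ffact (x 0 i) (be 0 i)).
Proof. by exists [:: (c, be)]; apply/funext => x; rewrite big_seq1. Qed.

Lemma ffspan_closed d (P : ('rV[CC]_d -> CC) -> 'rV[CC]_d -> CC) :
  (forall x, P (fun=> 0) x = 0) ->
  (forall p q x, P (fun y => p y + q y) x = P p x + P q x) ->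
  (forall c (be : 'rV[nat]_d), ffspan (P (fun x => c * \prod_(i < d) ffact (x 0 i) (be 0 i)))) ->
  forall q, ffspan q -> ffspan (P q).
Proof.
move=> P0 PD P1 q [s ->]; elim: s => [|y s IH].
  exists [::]; apply/funext => x; rewrite big_nil -[RHS](P0 x).
  by congr P; apply/funext => z; rewrite big_nil.
have := ffspanD (P1 y.1 y.2) IH.
have <- // : P (fun x => \sum_(y0 <- y :: s) y0.1 * \prod_(i < d) ffact (x 0 i) (y0.2 0 i)) =
  fun x => P (fun x => y.1 * \prod_(i < d) ffact (x 0 i) (y.2 0 i)) x +
    P (fun x => \sum_(y0 <- s) y0.1 * \prod_(i < d) ffact (x 0 i) (y0.2 0 i)) x.
apply/funext => x; rewrite -PD; congr P; apply/funext => z.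
by rewrite big_cons.
Qed.

(** From [z (z)_k = (z)_(k+1) + k (z)_k] in the coordinate [i]. *)
Lemma ffspanX d i (q : 'rV[CC]_d -> CC) : ffspan q -> ffspan (fun x => x 0 i * q x).
Proof.
apply: (@ffspan_closed _ (fun q x => x 0 i * q x)) => [x|p r x|c be].
- exact: mulr0.
- exact: mulrDr.
pose be' : 'rV[nat]_d := \row_(j < d) addn (be 0 j) (j == i).
have := ffspanD (ffspan1 c be') (ffspan1 ((be 0 i)%:R * c) be).
congr ffspan; apply/funext => x.
rewrite (bigD1 i) //= [in X in _ + X](bigD1 i) //= [in RHS](bigD1 i) //=.
have -> : \prod_(j < d | j != i) ffact (x 0 j) (be' 0 j) =
          \prod_(j < d | j != i) ffact (x 0 j) (be 0 j).
  by apply: eq_bigr => j /negbTE ji; rewrite !mxE ji addn0.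
rewrite !mxE eqxx addn1 {1}/ffact big_ord_recr /= -/(ffact _ _).
set u := ffact _ _; set v := \prod_(j | _) _; set z := x 0 i; set k := (_)%:R.
ring.
Qed.

Lemma polyfun_ffspan d (p : 'rV[CC]_d -> CC) : polyfun p -> ffspan p.
Proof.
(* Multiplication by [p] is shown to preserve the span, a form that passes through products; it is
   then applied to 1. *)
move=> [n hp]; suff H q : ffspan q -> ffspan (fun x => p x * q x).
  have := H _ (ffspan1 1 0); congr ffspan; apply/funext => x.
  by rewrite big1 ?mulr1 // => i _; rewrite mxE /ffact big_ord0.
elim: hp q => {n p} [n c|n i|n p q _ IHp _ IHq|m n p q _ IHp _ IHq] r hr.
- apply: (@ffspan_closed _ (fun r x => c * r x)) hr => [x|p q x|e be].
  + exact: mulr0.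
  + exact: mulrDr.
  + have := ffspan1 (c * e) be; congr ffspan; apply/funext => x; rewrite mulrA //.
- exact: ffspanX.
- have := ffspanD (IHp _ hr) (IHq _ hr).
  by congr ffspan; apply/funext => x; rewrite mulrDl.
have := IHp _ (IHq _ hr).
by congr ffspan; apply/funext => x; rewrite mulrA.
Qed.

(** Rests on [t^a d^beta = t^(a - beta) (theta)_beta]. *)
Lemma weyl_opL d (P : op d) : is_weyl P -> exists L, P = opL L.
Proof.
move=> [s ->].
have hp (c : CC) (be : 'rV[nat]_d) :
    polyfun (fun x : 'rV[CC]_d => c * \prod_(i < d) ffact (x 0 i) (be 0 i)).
  apply: polyfunZ; apply: polyfun_prod => i; apply: polyfun_prod => j.
  by apply: polyfunB; [exact: polyfunX|exact: polyfunC].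
exists [seq (y.1.2 - map_mx (fun k : nat => k%:Z) y.2, PFun (hp y.1.1 y.2)) | y <- s].
apply/funext => f; apply/funext => n; rewrite /weyl_op /opL big_map.
apply: eq_bigr => y _; rewrite /mono_op /mon /= opprB addrCA addrC; congr (_ * _ * _).
apply: eq_bigr => i _; rewrite /ffactC /ffact; apply: eq_bigr => j _.
by rewrite [in RHS]mxE intrB.
Qed.

Lemma weyl_mon d (a : Zd d) p : polyfun p -> is_weyl (mon a p).
Proof.
move=> /polyfun_ffspan [s ->].
exists [seq (y.1, a + map_mx (fun k : nat => k%:Z) y.2, y.2) | y <- s].
apply/funext => f; apply/funext => n; rewrite /weyl_op /mon big_map mulr_suml.
apply: eq_bigr => y _; rewrite /mono_op /= opprD addrA subrK; congr (_ * _ * _).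
apply: eq_bigr => i _; rewrite /ffactC /ffact; apply: eq_bigr => j _.
by rewrite [in LHS]mxE intrB.
Qed.

Lemma opL_weyl d (L : seq (Zd d * pfun d)) : is_weyl (opL L).
Proof.
elim: L => [|y L [s hs]].
  by exists [::]; apply/funext => f; apply/funext => n; rewrite /opL /weyl_op !big_nil.
have [t ht] := weyl_mon y.1 (pfunP y.2); exists (t ++ s).
apply/funext => f; apply/funext => n; rewrite /weyl_op big_cat /opL big_cons.
by rewrite -[\sum_(z <- L) _]/(opL L f n) hs ht.
Qed.

(** * The algebra D(R_A) and annihilator ideals *)

Lemma polyfun_vanish_mx (K : numFieldType) d (s : seq (Zd d)) (p : 'rV[K]_d -> K)
    (T : 'rV[K]_d -> Prop) x y :
  polyfun p -> (forall x a, T x -> a \in s -> T (x + iotaZ a)) ->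
  (forall x, T x -> p x = 0) ->
  T x -> (y <= \matrix_(i < size s) iotaZ (s`_i))%MS -> p (x + y) = 0.
Proof.
move=> hp hT h0 Tx /submxP [D ->]; rewrite mulmx_sum_row.
have hT' z a : T z -> a \in map iotaZ s -> T (z + a).
  by move=> Tz /mapP [b bs ->]; exact: hT.
have := polyfun_vanish hp hT' h0 (fun i => oapp (D 0) 0 (insub i)) Tx.
rewrite size_map; congr (p (_ + _) = 0); apply: eq_bigr => i _.
by rewrite valK rowK (nth_map 0).
Qed.

Lemma inNA0 d (A : seq (Zd d)) : inNA A 0.
Proof. by exists (fun=> 0%N); rewrite big1 // => i _; rewrite mulr0n. Qed.

Lemma inNAD d (A : seq (Zd d)) a b : inNA A a -> inNA A b -> inNA A (a + b).
Proof.
move=> [k ->] [l ->]; exists (fun i => (k i + l i)%N).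
by rewrite -big_split; apply: eq_bigr => i _; rewrite mulrnDr.
Qed.

Lemma inNA_mem d (A : seq (Zd d)) a : a \in A -> inNA A a.
Proof.
move=> aA; have lt : (index a A < size A)%N by rewrite index_mem.
exists (fun i => (i == Ordinal lt)%N); rewrite (bigD1 (Ordinal lt)) //= eqxx nth_index //.
by rewrite big1 ?addr0 // => i /negbTE ->.
Qed.

Lemma inNAMn d (A : seq (Zd d)) a n : inNA A a -> inNA A (a *+ n).
Proof.
move=> ha; elim: n => [|n IH]; first by rewrite mulr0n; exact: inNA0.
by rewrite mulrS; exact: inNAD.
Qed.

Lemma inNA_sum d (A : seq (Zd d)) (I : Type) (s : seq I) (F : I -> Zd d) :
  (forall i, inNA A (F i)) -> inNA A (\sum_(i <- s) F i).
Proof.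
move=> hF; elim: s => [|i s IH]; first by rewrite big_nil; exact: inNA0.
by rewrite big_cons; exact: inNAD.
Qed.

(** Split the integral coefficients by sign. *)
Lemma group_decomp d (A : seq (Zd d)) : generates_group A ->
  forall m, exists u w, [/\ inNA A u, inNA A w & m = u - w].
Proof.
move=> hA m; have [k ->] := hA m.
exists (\sum_(i < size A) A`_i *+ (if k i is Posz n then n else 0%N)).
exists (\sum_(i < size A) A`_i *+ (if k i is Negz n then n.+1 else 0%N)); split.
- by apply: inNA_sum => i; apply/inNAMn/inNA_mem/mem_nth.
- by apply: inNA_sum => i; apply/inNAMn/inNA_mem/mem_nth.
rewrite -sumrB; apply: eq_bigr => i _; case: (k i) => n.
  by rewrite mulr0n subr0.
by rewrite mulr0n sub0r NegzE mulrNz.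
Qed.

Lemma generates_full (K : numFieldType) d (A : seq (Zd d)) (y : 'rV[K]_d) :
  generates_group A -> (y <= \matrix_(i < size A) iotaZ (A`_i))%MS.
Proof.
move=> hA.
have hM (m : Zd d) : (@iotaZ K d m <= \matrix_(i < size A) iotaZ (A`_i))%MS.
  have [k ->] := hA m; rewrite iotaZ_sum; apply: summx_sub => i _.
  by rewrite iotaZMz; apply: scalemx_sub; apply: (eq_row_sub i); rewrite rowK.
rewrite [y]row_sum_delta; apply: summx_sub => j _; apply: scalemx_sub.
have -> : delta_mx 0 j = iotaZ (delta_mx 0 j) :> 'rV[K]_d.
  by apply/rowP => i; rewrite !mxE; case: (_ && _).
exact: hM.
Qed.

(** A translate of NA is Zariski dense: it is closed under adding elements of [A], which span the
    whole space. *)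
Lemma polyfun_NA_zero (K : numFieldType) d (A : seq (Zd d)) (p : 'rV[K]_d -> K) x0 :
  generates_group A -> polyfun p ->
  (forall m, inNA A m -> p (x0 + iotaZ m) = 0) -> forall x, p x = 0.
Proof.
move=> hA hp h0 x; rewrite -[x](subrK x0) addrC.
apply: (polyfun_vanish_mx (T := fun y => exists2 m, inNA A m & y = x0 + iotaZ m) hp _ _ _
  (generates_full (x - x0) hA)).
- move=> _ a [m hm ->] aA; exists (m + a); last by rewrite iotaZD addrA.
  by apply: inNAD => //; exact: inNA_mem.
- by move=> _ [m hm ->]; exact: h0.
by exists 0; [exact: inNA0|rewrite iotaZ0 addr0].
Qed.

(** Symbols are read off the action on monomials, and lattice points are Zariski dense. *)
Lemma symL_inj d (A : seq (Zd d)) (L M : seq (Zd d * pfun d)) :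
  generates_group A -> opL L = opL M -> symL L = symL M.
Proof.
move=> hA e; apply/funext => a; apply/funext => x; apply/eqP; rewrite -subr_eq0; apply/eqP.
move: x; apply: (polyfun_NA_zero (x0 := 0) hA).
  by apply: polyfunB; exact: polyfun_symL.
by move=> m _; rewrite add0r -!opL_delta e subrr.
Qed.

Lemma symL_monP d (a : Zd d) p (hp : polyfun p) x : symL (monP a hp) a x = p x.
Proof. by rewrite /symL big_cons eqxx big_nil addr0. Qed.

Lemma in_DRA_symL d (A : seq (Zd d)) (L : seq (Zd d * pfun d)) m a :
  in_DRA A (opL L) -> inNA A m -> symL L a (iotaZ m) != 0 -> inNA A (m + a).
Proof.
move=> [_ hL] hm; rewrite -opL_delta; apply: (hL (delta m) _).2.
split; first by exists [:: m] => n; rewrite /delta inE; case: (n == m); rewrite ?eqxx.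
by move=> n; rewrite /delta; case: (n =P m) => [->|]; rewrite ?eqxx.
Qed.

Lemma in_DRA_mon d (A : seq (Zd d)) a p :
  polyfun p -> (forall m, inNA A m -> ~ inNA A (m + a) -> p (iotaZ m) = 0) ->
  in_DRA A (mon a p).
Proof.
move=> hp h0; split; first exact: weyl_mon.
move=> f [[s hs] hf]; split.
  exists [seq x + a | x <- s] => n; rewrite /mon mulf_eq0 negb_or => /andP [_ h].
  by apply/mapP; exists (n - a); rewrite ?subrK //; exact: hs.
move=> n; rewrite /mon mulf_eq0 negb_or => /andP [hp0 /hf h].
apply: contrapT => hn; move/eqP: hp0; apply; apply: h0 => //.
by rewrite subrK.
Qed.

Lemma in_DRA0 d (A : seq (Zd d)) : in_DRA A (@op0 d).
Proof.
split; last by move=> f _; split; [exists [::] => n|move=> n]; rewrite /op0 eqxx.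
by exists [::]; apply/funext => f; apply/funext => n; rewrite /weyl_op big_nil.
Qed.

Lemma in_DRAB d (A : seq (Zd d)) P Q : in_DRA A P -> in_DRA A Q -> in_DRA A (opB P Q).
Proof.
move=> [/weyl_opL [L ->] hP] [/weyl_opL [M ->] hQ]; split.
  by rewrite -opL_sub; exact: opL_weyl.
move=> f hf; have [[s hs] sP] := hP f hf; have [[t ht] tQ] := hQ f hf.
have aux n : opB (opL L) (opL M) f n != 0 -> opL L f n != 0 \/ opL M f n != 0.
  rewrite /opB; case: (opL L f n =P 0) => [->|/eqP]; last by left.
  by rewrite sub0r oppr_eq0; right.
split; first by exists (s ++ t) => n /aux; rewrite mem_cat => -[/hs|/ht] ->; rewrite ?orbT.
by move=> n /aux [/sP|/tQ].
Qed.

Lemma in_DRAM d (A : seq (Zd d)) P Q : in_DRA A P -> in_DRA A Q -> in_DRA A (opM P Q).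
Proof.
move=> [/weyl_opL [L ->] hP] [/weyl_opL [M ->] hQ]; split.
  by rewrite -opL_mul; exact: opL_weyl.
by move=> f /hQ /hP.
Qed.

(* [B] plays the role of the weights of a subquotient of a module of the form
   C[t^{±1}] t^alpha; its annihilator is the two-sided ideal of operators all of
   whose matrix coefficients between weights in [B] vanish. *)
Lemma not_simple_of_weights d (A : seq (Zd d)) (B : 'rV[CC]_d -> Prop) a p :
  generates_group A ->
  (exists x, B x) ->
  (forall L M x b c, in_DRA A (opL L) -> in_DRA A (opL M) -> B x -> B (x + iotaZ b + iotaZ c) ->
     symL M b x != 0 -> symL L c (x + iotaZ b) != 0 -> B (x + iotaZ b)) ->
  polyfun p -> (exists x, p x != 0) -> in_DRA A (mon a p) ->
  (forall x, B x -> B (x + iotaZ a) -> p x = 0) ->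
  ~ DRA_simple A.
Proof.
move=> hA [x0 Bx0] conv hp [x1 px1] hD hB simple.
pose ann (L : seq (Zd d * pfun d)) := forall x b, B x -> B (x + iotaZ b) -> symL L b x = 0.
pose I P := in_DRA A P /\ exists2 L, P = opL L & ann L.
have [|I0|I1] := simple I.
- split.
  + by move=> P [].
  + split; first exact: in_DRA0.
    exists [::]; last by move=> x b _ _; rewrite /symL big_nil.
    by apply/funext => f; apply/funext => n; rewrite /opL big_nil.
  + move=> P Q [hP [L eL aL]] [hQ [M eM aM]]; split; first exact: in_DRAB.
    exists (subL L M); first by rewrite opL_sub eL eM.
    by move=> x b Bx Bb; rewrite symL_sub aL // aM // subrr.
  move=> P Q hP [hQ [M eM aM]]; have [wP _] := hP; have [L eL] := weyl_opL wP.
  rewrite eL in hP *; rewrite eM in hQ *.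
  split; (split; first exact: in_DRAM).
    exists (mulL L M); first by rewrite opL_mul.
    move=> x c Bx Bc; rewrite symL_mul big1 // => b _.
    (* A nonzero product of symbols passes through an intermediate weight, which [conv] puts in
       [B]. *)
    case: (symL L (c - b) (x + iotaZ b) =P 0) => [->|/eqP n1]; first by rewrite mul0r.
    case: (symL M b x =P 0) => [->|/eqP n2]; first by rewrite mulr0.
    rewrite aM ?mulr0 //; apply: conv n2 n1 => //.
    by rewrite -addrA -iotaZD subrKC.
  exists (mulL M L); first by rewrite opL_mul.
  move=> x c Bx Bc; rewrite symL_mul big1 // => b _.
  have Bc' : B (x + iotaZ b + iotaZ (c - b)) by rewrite -addrA -iotaZD subrKC.
  case: (symL M (c - b) (x + iotaZ b) =P 0) => [->|/eqP n1]; first by rewrite mul0r.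
  case: (symL L b x =P 0) => [->|/eqP n2]; first by rewrite mulr0.
  rewrite aM ?mul0r //; exact: conv n2 n1.
(* If this ideal is zero, [p] vanishes on NA, hence everywhere. *)
- have : I (mon a p).
    split=> //; exists (monP a hp); first by rewrite opL_monP.
    move=> x b Bx Bb; rewrite /symL big_mkcond big_seq1; case: (a =P b) => // ab.
    by apply: hB => //; rewrite ab.
  move=> /I0 e0; suff : p x1 = 0 by move/eqP: px1.
  move: x1 {px1}; apply: (polyfun_NA_zero (x0 := 0) hA hp) => m _.
  by rewrite add0r -(symL_monP a hp) -opL_delta opL_monP e0.
(* If it is everything, it contains 1, whose degree 0 symbol at [x0] is not zero. *)
have [_ [L eL aL]] : I (mon 0 (fun=> 1)).
  apply/I1; apply: in_DRA_mon; first exact: polyfunC.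
  by move=> m hm []; rewrite addr0.
move: eL; rewrite -(opL_monP 0 (polyfunC d 1)) => /(symL_inj hA) e.
have := aL x0 0; rewrite iotaZ0 addr0 -e symL_monP => /(_ Bx0 Bx0) /eqP.
by rewrite oner_eq0.
Qed.

(** * Farkas and Gordan *)

Definition dot (K : pzRingType) (d : nat) (u v : 'rV[K]_d) : K := \sum_(i < d) u 0 i * v 0 i.

Lemma dotDr (K : pzRingType) d (u v w : 'rV[K]_d) : dot u (v + w) = dot u v + dot u w.
Proof. by rewrite /dot -big_split; apply: eq_bigr => i _; rewrite mxE mulrDr. Qed.
Lemma dotDl (K : pzRingType) d (u v w : 'rV[K]_d) : dot (u + v) w = dot u w + dot v w.
Proof. by rewrite /dot -big_split; apply: eq_bigr => i _; rewrite mxE mulrDl. Qed.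
Lemma dotZr (K : comPzRingType) d c (u v : 'rV[K]_d) : dot u (c *: v) = c * dot u v.
Proof. by rewrite /dot mulr_sumr; apply: eq_bigr => i _; rewrite mxE mulrCA. Qed.
Lemma dotZl (K : pzRingType) d c (u v : 'rV[K]_d) : dot (c *: u) v = c * dot u v.
Proof. by rewrite /dot mulr_sumr; apply: eq_bigr => i _; rewrite mxE mulrA. Qed.
Lemma dotNr (K : pzRingType) d (u v : 'rV[K]_d) : dot u (- v) = - dot u v.
Proof. by rewrite /dot -sumrN; apply: eq_bigr => i _; rewrite mxE mulrN. Qed.
Lemma dotNl (K : pzRingType) d (u v : 'rV[K]_d) : dot (- u) v = - dot u v.
Proof. by rewrite /dot -sumrN; apply: eq_bigr => i _; rewrite mxE mulNr. Qed.
Lemma dotBr (K : pzRingType) d (u v w : 'rV[K]_d) : dot u (v - w) = dot u v - dot u w.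
Proof. by rewrite dotDr dotNr. Qed.
Lemma dot0r (K : pzRingType) d (u : 'rV[K]_d) : dot u 0 = 0.
Proof. by rewrite /dot big1 // => i _; rewrite mxE mulr0. Qed.
Lemma dot0l (K : pzRingType) d (u : 'rV[K]_d) : dot 0 u = 0.
Proof. by rewrite /dot big1 // => i _; rewrite mxE mul0r. Qed.
Lemma dot_suml (K : pzRingType) d (I : Type) (s : seq I) (F : I -> 'rV[K]_d) v :
  dot (\sum_(i <- s) F i) v = \sum_(i <- s) dot (F i) v.
Proof. by elim: s => [|i s IH]; rewrite ?big_nil ?dot0l // !big_cons dotDl IH. Qed.
Lemma dot_sumr (K : pzRingType) d (I : Type) (s : seq I) (F : I -> 'rV[K]_d) v :
  dot v (\sum_(i <- s) F i) = \sum_(i <- s) dot v (F i).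
Proof. by elim: s => [|i s IH]; rewrite ?big_nil ?dot0r // !big_cons dotDr IH. Qed.
Lemma dot_mx (K : comPzRingType) d (u v : 'rV[K]_d) : v *m u^T = (dot u v)%:M.
Proof.
apply/matrixP => i j; rewrite !ord1 !mxE mulr1n; apply: eq_bigr => k _.
by rewrite mxE mulrC.
Qed.
Lemma dot_iotaZ (K : pzRingType) d (u v : 'rV[int]_d) :
  dot (iotaZ u) (iotaZ v) = (dot u v)%:~R :> K.
Proof. by rewrite /dot rmorph_sum; apply: eq_bigr => i _; rewrite !mxE -intrM. Qed.
Lemma dot_self_gt0 (K : realDomainType) d (u : 'rV[K]_d) : u != 0 -> 0 < dot u u.
Proof.
move=> u0; rewrite lt_def sumr_ge0 ?andbT => [|i _]; last by rewrite -expr2 sqr_ge0.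
apply: contra u0; rewrite psumr_eq0 => [/allP h|i _]; last by rewrite -expr2 sqr_ge0.
apply/eqP/rowP => i; have := h i (mem_index_enum i).
by rewrite -expr2 sqrf_eq0 mxE => /eqP.
Qed.

Lemma dot_row_mx (K : pzRingType) m n (a c : 'rV[K]_m) (b e : 'rV[K]_n) :
  dot (row_mx a b) (row_mx c e) = dot a c + dot b e.
Proof.
rewrite /dot big_split_ord; congr (_ + _); apply: eq_bigr => i _.
  by rewrite !row_mxEl.
by rewrite !row_mxEr.
Qed.

Definition fcons (T : Type) (x : T) (c : nat -> T) (i : nat) : T := if i is k.+1 then c k else x.

(* Induction on the generators: when the functional found for the tail is negative on
   the head [a], project everything along [a] onto its kernel. *)
Lemma farkas (K : realFieldType) d (s : seq 'rV[K]_d) m :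
  (exists c : nat -> K, (forall i, 0 <= c i) /\ m = \sum_(i < size s) c i *: s`_i) \/
  (exists F : 'rV[K]_d, (forall a, a \in s -> 0 <= dot F a) /\ dot F m < 0).
Proof.
have [n] := ubnP (size s); elim: n s m => // n IH [|a s] m.
  move=> _; have [->|m0] := eqVneq m 0.
    by left; exists (fun=> 0); split=> //; rewrite big_ord0.
  by right; exists (- m); split=> //; rewrite dotNl oppr_lt0 dot_self_gt0.
rewrite ltnS => sn; case: (IH s m sn) => [[c [c0 ->]]|[F [Fs Fm]]].
  left; exists (fcons 0 c); split; first by case.
  by rewrite lincomb_cons scale0r add0r.
have [Fa|Fa] := lerP 0 (dot F a).
  by right; exists F; split=> // b; rewrite inE => /predU1P [->|/Fs].
pose proj b := b - (dot F b / dot F a) *: a.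
case: (IH (map proj s) (proj m)); first by rewrite size_map.
  move=> [c [c0 e]]; left.
  (* The coefficient of [a] that undoes the projections; it is nonnegative because [F] is negative
     at [m] and [a] and nonnegative on [s]. *)
  pose e0 := dot F m / dot F a - \sum_(i < size s) c i * (dot F s`_i / dot F a).
  exists (fcons e0 c); split.
    case=> [|i]; last exact: c0.
    rewrite subr_ge0; apply: (@le_trans _ _ 0).
      apply: sumr_le0 => i _; apply: mulr_ge0_le0 => //.
      apply: mulr_ge0_le0; first by apply/Fs/mem_nth.
      by rewrite invr_le0 ltW.
    by rewrite -mulrNN -invrN mulr_ge0 ?invr_ge0 ?oppr_ge0 ?ltW.
  have E : \sum_(i < size (map proj s)) c i *: (map proj s)`_i =
      \sum_(i < size s) c i *: s`_i
      - (\sum_(i < size s) c i * (dot F s`_i / dot F a)) *: a.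
    rewrite size_map scaler_suml -sumrB; apply: eq_bigr => i _.
    by rewrite (nth_map 0) // scalerBr scalerA.
  move/eqP: e; rewrite /proj subr_eq -/proj E => /eqP ->.
  by rewrite lincomb_cons /= /e0 scalerBl addrC addrCA [RHS]addrC.
move=> [G [Gs Gm]]; right.
(* [H] is [G] composed with the projection, so it vanishes on [a]. *)
pose H := G - (dot G a / dot F a) *: F.
have HE b : dot H b = dot G (proj b).
  by rewrite /H /proj dotDl dotNl dotZl dotBr dotZr; ring.
exists H; split=> [b|]; last by rewrite HE.
rewrite inE => /predU1P [->|bs]; last by rewrite HE Gs // map_f.
by rewrite HE /proj divff ?lt_eqF // scale1r subrr dot0r.
Qed.

(** Farkas for the vectors [(1, a)] and the target [(1, 0)]: a conical combination is a convex
    relation, and a separating functional [(t, g)] has [t < 0], which makes [g] positive on [s]. *)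
Lemma gordan (K : realFieldType) d (s : seq 'rV[K]_d) :
  (exists g : 'rV[K]_d, forall a, a \in s -> 0 < dot g a) \/
  (exists c : nat -> K, [/\ forall i, 0 <= c i, \sum_(i < size s) c i = 1 &
     \sum_(i < size s) c i *: s`_i = 0]).
Proof.
pose lift1 (a : 'rV[K]_d) : 'rV[K]_(1 + d) := row_mx 1%:M a.
have [[c [c0 e]]|[F [Fs Fm]]] := farkas (map lift1 s) (row_mx 1%:M 0).
  right; exists c; move: e; rewrite size_map.
  have -> : \sum_(i < size s) c i *: (map lift1 s)`_i =
      row_mx (\sum_(i < size s) c i *: 1%:M) (\sum_(i < size s) c i *: s`_i).
    transitivity (\sum_(i < size s) row_mx (c i *: 1%:M) (c i *: s`_i)).
      by apply: eq_bigr => i _; rewrite (nth_map 0) // scale_row_mx.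
    elim/big_rec3: _ => [|i x y z _ ->]; first by rewrite row_mx0.
    by rewrite add_row_mx.
  move=> /eq_row_mx [e1 e2]; split=> //.
  have := congr1 (fun M : 'rV_1 => M 0 0) e1.
  rewrite mxE summxE eqxx => h; refine (etrans _ (esym h)); apply: eq_bigr => i _.
  by rewrite !mxE mulr1.
left; move: Fs Fm; rewrite -[F]hsubmxK; set t := lsubmx F; set g := rsubmx F => Fs.
rewrite dot_row_mx dot0r addr0 => Fm.
exists g => a /(map_f lift1) /Fs; rewrite /lift1 dot_row_mx => h.
by rewrite -(ltrD2l (dot t 1%:M)) addr0; exact: lt_le_trans h.
Qed.

(** * Facets *)

Lemma exists_min_seq (K : realDomainType) (T : eqType) (f : T -> K) (s : seq T) :
  s != [::] -> exists2 x, x \in s & forall y, y \in s -> f x <= f y.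
Proof.
elim: s => // a [|b s] IH _.
  by exists a; rewrite ?inE // => y; rewrite inE => /eqP ->.
have [//|x xs hx] := IH.
have [le|lt] := lerP (f a) (f x).
  exists a; first by rewrite inE eqxx.
  by move=> y; rewrite inE => /predU1P [-> //|/hx]; exact: le_trans.
exists x; first by rewrite inE xs orbT.
by move=> y; rewrite inE => /predU1P [->|/hx //]; exact: ltW.
Qed.

Lemma sub_count_lt (T : eqType) (P Q : pred T) (s : seq T) x :
  {in s, forall y, P y -> Q y} -> x \in s -> Q x -> ~~ P x -> (count P s < count Q s)%N.
Proof.
elim: s => // a s IH PQ; rewrite inE => /predU1P [->|xs] Qx Px /=.
  rewrite (negbTE Px) Qx add0n add1n ltnS; elim: s {IH} PQ => //= b s IH PQ.
  apply: leq_add.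
    by move: (PQ b); rewrite !inE eqxx orbT => /(_ isT); case: (P b) => // ->.
  by apply: IH => y ys; apply: PQ; move: ys; rewrite !inE => /orP [->|->]; rewrite ?orbT.
have : (count P s < count Q s)%N.
  by apply: IH => // y ys; apply: PQ; rewrite inE ys orbT.
have : (P a <= Q a)%N by move: (PQ a); rewrite inE eqxx => /(_ isT); case: (P a) => // ->.
by lia.
Qed.

Lemma clear_denominators d (g : 'rV[rat]_d) :
  exists (N : nat) (v : 'rV[int]_d), (0 < N)%N /\ iotaZ v = N%:R *: g.
Proof.
pose N := \prod_(i < d) denq (g 0 i).
have N0 : 0 < N by apply: prodr_gt0 => i _; exact: denq_gt0.
exists `|N|%N, (\row_i (numq (g 0 i) * \prod_(j < d | j != i) denq (g 0 j))).
split; first by rewrite absz_gt0 gt_eqF.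
apply/rowP => i; rewrite !mxE -[`|N|%N%:R]/((`|N|%N : int)%:~R) gtz0_abs //.
rewrite /N [in RHS](bigD1 i) //= !rmorphM /= numqE.
by rewrite [RHS]mulrC mulrA.
Qed.

Lemma evZ_dot d (F m : Zd d) : evZ F m = dot F m. Proof. by []. Qed.

Lemma evZMz d (F m : Zd d) z : evZ F (m *~ z) = evZ F m * z.
Proof. by rewrite evZ_dot -(scaler_int z m) dotZr intz mulrC. Qed.

Lemma evZ_delta d (F : Zd d) i : evZ F (delta_mx 0 i) = F 0 i.
Proof.
rewrite /evZ (bigD1 i) //= mxE !eqxx mulr1 big1 ?addr0 // => j /negbTE ji.
by rewrite mxE ji andbF mulr0.
Qed.

(** The least positive value of [v] on the lattice divides every value, by division with remainder;
    dividing [v] by it gives the form. *)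
Lemma primitive_form d (v : Zd d) : v != 0 ->
  exists (F : Zd d) (e : nat), [/\ (0 < e)%N, v = F *+ e & forall z : int, exists m, evZ F m = z].
Proof.
move=> v0; pose P k := `[< exists m, evZ v m = k.+1%:Z >].
have exP : exists k, P k.
  have [i vi] : exists i, v 0 i != 0.
    by apply/existsP; apply: contraNT v0 => /existsPn h; apply/eqP/rowP => i; rewrite mxE;
       apply/eqP; move: (h i); rewrite negbK.
  exists (absz (v 0 i)).-1; apply/asboolP; rewrite prednK ?absz_gt0 //.
  have [h|h] := lerP 0 (v 0 i).
    by exists (delta_mx 0 i); rewrite evZ_delta gez0_abs.
  by exists (- delta_mx 0 i); rewrite evZ_dot dotNr -evZ_dot evZ_delta ltz0_abs.
case: (ex_minnP exP) => k /asboolP [m0 hm0] kmin.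
have dv m : (k.+1 %| evZ v m)%Z.
  apply/dvdz_mod0P; apply: contrapT => /eqP r0.
  have rge : 0 <= (evZ v m %% k.+1)%Z by exact: modz_ge0.
  have rlt : (evZ v m %% k.+1)%Z < k.+1 by exact: ltz_pmod.
  have : P (absz (evZ v m %% k.+1)%Z).-1.
    apply/asboolP; exists (m - m0 *~ (evZ v m %/ k.+1)%Z).
    rewrite prednK ?absz_gt0 // gez0_abs // evZ_dot dotBr -!evZ_dot evZMz hm0 mulrC.
    by rewrite {1}(divz_eq (evZ v m) k.+1) addrAC subrr add0r.
  by move=> /kmin; lia.
pose F : Zd d := \row_i divz (v 0 i) k.+1.
have vF : v = F *+ k.+1.
  apply/rowP => i; rewrite -scaler_nat !mxE natz mulrC divzK //.
  by rewrite -evZ_delta.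
exists F, k.+1; split=> // z; exists (m0 *~ z).
have e : evZ v m0 = k.+1%:Z * evZ F m0 by rewrite {1}vF !evZ_dot -scaler_nat dotZl natz.
have : evZ F m0 = 1 by apply: (@mulfI _ k.+1%:Z); rewrite // mulr1 -e.
by rewrite evZMz => ->; rewrite mul1r.
Qed.

(** Some column of the cokernel matrix kills the rows of [M] but not [e]. *)
Lemma separating_form (K : fieldType) m n (M : 'M[K]_(m, n)) (e : 'rV[K]_n) : ~~ (e <= M)%MS ->
  exists2 y : 'rV[K]_n, dot y e != 0 & forall v : 'rV_n, (v <= M)%MS -> dot y v = 0.
Proof.
have dotE j (v : 'rV_n) : dot (row j (cokermx M)^T) v = (v *m cokermx M) 0 j.
  have := dot_mx (row j (cokermx M)^T) v; rewrite -{1}tr_col trmxK colE mulmxA -colE.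
  by move=> /matrixP /(_ 0 0); rewrite !mxE eqxx mulr1n.
rewrite submxE => eM; have [j ej] : exists j, (e *m cokermx M) 0 j != 0.
  apply/existsP; apply: contraNT eM => /existsPn h; apply/eqP/rowP => j.
  by rewrite [RHS]mxE; apply/eqP; move: (h j); rewrite negbK.
exists (row j (cokermx M)^T); first by rewrite dotE.
by move=> v; rewrite submxE dotE => /eqP ->; rewrite mxE.
Qed.

Lemma exists_orthogonal (K : fieldType) m n (M : 'M[K]_(m, n)) : (\rank M < n)%N ->
  exists2 G : 'rV[K]_n, G != 0 & forall v : 'rV_n, (v <= M)%MS -> dot G v = 0.
Proof.
move=> rM; have : ~~ (1%:M <= M)%MS by rewrite sub1mx /row_full ltn_eqF.
move=> /row_subPn [i /separating_form [y yi hy]]; exists y => //.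
by apply: contraNneq yi => ->; rewrite dot0l.
Qed.

Lemma full_dot_neq0 (K : numFieldType) d (A : seq (Zd d)) (G : 'rV[K]_d) :
  generates_group A -> G != 0 -> exists2 a, a \in A & dot G (iotaZ a) != 0.
Proof.
move=> hA G0; apply: contrapT => h.
move/eqP: G0; apply; apply/rowP => i; rewrite mxE.
suff : forall y : 'rV[K]_d, dot G y = 0.
  move=> /(_ (delta_mx 0 i)); rewrite /dot (bigD1 i) //= mxE !eqxx mulr1 big1 ?addr0 //.
  by move=> j /negbTE ji; rewrite mxE ji andbF mulr0.
move=> y; have /submxP [D ->] := generates_full y hA.
rewrite mulmx_sum_row dot_sumr big1 // => j _; rewrite dotZr rowK.
apply/eqP; rewrite mulf_eq0; apply/orP; right; apply: contraT => ne.
by case: h; exists A`_j; first exact: mem_nth.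
Qed.

Definition zeros d (A : seq (Zd d)) (F : 'rV[rat]_d) := [seq a <- A | dot F (iotaZ a) == 0].

(** Clearing denominators and dividing by the content turns [F] into a primitive integral form with
    the same signs. *)
Lemma facet_form_of_rank d (A : seq (Zd d)) (F : 'rV[rat]_d) : generates_group A ->
  (forall a, a \in A -> 0 <= dot F (iotaZ a)) -> F != 0 ->
  (d.-1 <= \rank (\matrix_(j < size (zeros A F)) toQ ((zeros A F)`_j))%R)%N ->
  exists2 F' : Zd d, facet_form A F' & forall m, (evZ F' m < 0) = (dot F (iotaZ m) < 0).
Proof.
move=> hA hF F0 hr.
have [N [v [N0 hv]]] := clear_denominators F.
have v0 : v != 0.
  apply: contra F0 => /eqP v0; move: hv; rewrite v0 iotaZ0 => /esym/eqP.
  by rewrite scaler_eq0 pnatr_eq0 eqn0Ngt N0.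
have [F' [e [e0 ve F'1]]] := primitive_form v0.
have E m : (evZ F' m)%:~R * e%:R = N%:R * dot F (iotaZ m) :> rat.
  rewrite -dotZl -hv ve dot_iotaZ evZ_dot -scaler_nat dotZl mulrC natz intrM //.
have sE m : ((evZ F' m < 0) = (dot F (iotaZ m) < 0)) * ((evZ F' m == 0) = (dot F (iotaZ m) == 0)).
  have N0' : 0 < N%:R :> rat by rewrite ltr0n.
  have e0' : 0 < e%:R :> rat by rewrite ltr0n.
  split.
    by rewrite -(pmulr_rlt0 _ N0') -E pmulr_llt0 // ltrz0.
  apply/idP/idP => [/eqP h|/eqP h]; move: (E m); rewrite h.
    by rewrite mul0r => /esym/eqP; rewrite mulf_eq0 gt_eqF.
  by rewrite mulr0 => /eqP; rewrite mulf_eq0 (gt_eqF e0') orbF intr_eq0.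
exists F'; last by move=> m; rewrite sE.
split=> //.
  by move=> a aA; rewrite leNgt sE -leNgt hF.
exists (zeros A F); split.
  by move=> a; rewrite mem_filter => /andP [h aA]; split=> //; apply/eqP; rewrite sE.
apply/eqP; rewrite eqn_leq hr andbT.
(* [F] is a nonzero vector orthogonal to its zero set, so the rank cannot exceed [d.-1]. *)
have : (F <= kermx (\matrix_(j < size (zeros A F)) toQ ((zeros A F)`_j))%R^T)%MS.
  rewrite sub_kermx; apply/eqP/rowP => j; rewrite !mxE.
  have := mem_nth 0 (ltn_ord j); rewrite mem_filter => /andP [/eqP h _].
  rewrite -[RHS]h; apply: eq_bigr => i _; rewrite !mxE //.
move=> /mxrankS; rewrite mxrank_ker mxrank_tr rank_rV F0; set r := \rank _; clearbody r; rewrite /=; lia.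
Qed.

(* Rotate [F] around its zero set, keeping its value at [m], until it meets a new
   generator; the zero set grows, so this ends at a facet. *)
Lemma facet_separation d (A : seq (Zd d)) (F : 'rV[rat]_d) m : generates_group A ->
  (forall a, a \in A -> 0 <= dot F (iotaZ a)) -> dot F (iotaZ m) < 0 ->
  exists2 F' : Zd d, facet_form A F' & evZ F' m < 0.
Proof.
move=> hA.
(* The measure is the number of generators not killed by [F]. *)
have [n] := ubnP (size A - count (fun a => dot F (iotaZ a) == 0%R) A); elim: n F => // n IH F.
rewrite ltnS => hn hF Fm.
have F0 : F != 0 by apply: contraTneq Fm => ->; rewrite dot0l ltxx.
pose M := \matrix_(j < size (zeros A F)) toQ ((zeros A F)`_j).
have [hr|hr] := leqP d.-1 (\rank M).
  by have [F' fF' e] := facet_form_of_rank hA hF F0 hr; exists F'; rewrite ?e.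
(* The zeros of [F] and [m] together have rank below [d], which leaves a direction of rotation. *)
have [|G0 G0n G0M] := @exists_orthogonal _ _ _ (col_mx M (toQ m)).
  rewrite -addsmxE; apply: leq_ltn_trans (mxrank_adds_leqif M (toQ m)) _.
  apply: leq_ltn_trans (_ : (_ <= \rank M + 1)%N) _; first by rewrite leq_add2l rank_leq_row.
  by rewrite addn1; move: hr; move: (\rank M); clear; case: d => // n r; rewrite ltnS.
have Gm0 : dot G0 (iotaZ m) = 0 by apply: G0M; rewrite -addsmxE addsmxSr.
have Gz0 a : a \in A -> dot F (iotaZ a) = 0 -> dot G0 (iotaZ a) = 0.
  move=> aA Fa; apply: G0M; rewrite -addsmxE; apply: submx_trans (addsmxSl _ _).
  have az : a \in zeros A F by rewrite mem_filter Fa eqxx.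
  have lt : (index a (zeros A F) < size (zeros A F))%N by rewrite index_mem.
  by apply: (eq_row_sub (Ordinal lt)); rewrite rowK nth_index.
have [G [Gm Gz [a1 a1A Ga1]]] : exists G : 'rV[rat]_d, [/\ dot G (iotaZ m) = 0,
    forall a, a \in A -> dot F (iotaZ a) = 0 -> dot G (iotaZ a) = 0 &
    exists2 a, a \in A & dot G (iotaZ a) < 0].
  have [a aA] := full_dot_neq0 hA G0n; rewrite neq_lt => /orP [h|h].
    by exists G0; split=> //; exists a.
  exists (- G0); split; first by rewrite dotNl Gm0 oppr0.
    by move=> b bA Fb; rewrite dotNl Gz0 ?oppr0.
  by exists a; rewrite ?dotNl ?oppr_lt0.
pose s := [seq a <- A | dot G (iotaZ a) < 0].
have [|a0] := @exists_min_seq _ _ (fun a => dot F (iotaZ a) / - dot G (iotaZ a)) s.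
  by apply: contraTneq (_ : a1 \in s) => [->|]; rewrite ?mem_filter ?Ga1.
rewrite mem_filter => /andP [Ga0 a0A] amin.
(* The least ratio is the largest step keeping [F + t G] nonnegative on [A]; it makes [a0] a new
   zero. *)
set t := _ / _ in amin.
have t0 : 0 <= t by rewrite divr_ge0 ?hF // oppr_ge0 ltW.
pose F' := F + t *: G.
have F'E x : dot F' x = dot F x + t * dot G x by rewrite /F' dotDl dotZl.
have F'0 : dot F' (iotaZ a0) = 0.
  by rewrite F'E /t invrN mulrN mulNr mulfVK ?subrr // lt_eqF.
apply: (IH F').
- apply: leq_trans hn; apply: ltn_sub2l; last first.
    apply: (@sub_count_lt _ _ _ _ a0) => //.
    + by move=> a aA /eqP Fa; rewrite F'E Fa Gz // mulr0 addr0.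
    + by rewrite F'0.
    + by apply/eqP => /(Gz _ a0A) h; move: Ga0; rewrite h ltxx.
  rewrite ltn_neqAle count_size andbT -all_count; apply/allPn; exists a0 => //.
  by apply/eqP => /(Gz _ a0A) h; move: Ga0; rewrite h ltxx.
- move=> a aA; rewrite F'E.
  have [Ga|Ga] := lerP 0 (dot G (iotaZ a)).
    by rewrite addr_ge0 ?hF // mulr_ge0.
  have : a \in s by rewrite mem_filter Ga.
  move=> /amin; rewrite ler_pdivlMr ?oppr_gt0 // mulrN.
  by rewrite lerNl -subr_ge0 opprK addrC.
by rewrite F'E Gm mulr0 addr0.
Qed.

(** * Conductor and facet stability *)

(** Otherwise Farkas gives a separating functional, which [facet_separation] replaces by a facet
    form. *)
Lemma facet_cone d (A : seq (Zd d)) (m : Zd d) : generates_group A ->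
  (forall F, facet_form A F -> 0 <= evZ F m) ->
  exists c : nat -> rat, (forall i, 0 <= c i) /\
    iotaZ m = \sum_(i < size A) c i *: iotaZ (A`_i).
Proof.
move=> hA hm; have [[c [c0 e]]|[F [hF Fm]]] := farkas (map iotaZ A) (iotaZ m : 'rV[rat]_d).
  exists c; split=> //; rewrite e size_map; apply: eq_bigr => i _.
  by rewrite (nth_map 0).
have [|F' /hm F'm] := facet_separation hA _ Fm; last by rewrite ltNge F'm.
by move=> a aA; apply: hF; exact: map_f.
Qed.

(* Subtracting the integral part of a rational conical combination leaves a lattice
   point in a fixed box, and there are finitely many of these. *)
Lemma conductor d (A : seq (Zd d)) : generates_group A ->
  exists2 b, inNA A b &
    forall m, (forall F, facet_form A F -> 0 <= evZ F m) -> inNA A (m + b).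
Proof.
move=> hA.
(* [B] bounds each coordinate of a combination of [A] with coefficients in [[0, 1]]; [r] enumerates
   the lattice points of that box. *)
pose B := (\sum_(i < size A) \sum_(j < d) absz (nth 0%R A i 0%R j))%N.
pose r (g : {ffun 'I_d -> 'I_(B + B).+1}) : Zd d := \row_j ((g j)%:Z - B%:Z).
have /choice [w hw] : forall g, exists w, inNA A w /\ inNA A (r g + w).
  move=> g; have [u [w [hu hw e]]] := group_decomp hA (r g).
  by exists w; split; rewrite // e subrK.
(* The sum over the whole box serves every [m]: one term corrects its remainder, the others stay in
   NA. *)
exists (\sum_g w g); first by apply: inNA_sum => g; exact: (hw g).1.
move=> m hm; have [c [c0 ec]] := facet_cone hA hm.
pose n i := Num.trunc (c i).
have cn i : 0 <= c i - (n i)%:R <= 1.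
  by have /andP [h1 h2] := truncn_itv (c0 i); rewrite subr_ge0 h1 lerBlDr addrC natr1 ltW.
pose q := m - \sum_(i < size A) A`_i *+ n i.
have qE : iotaZ q = \sum_(i < size A) (c i - (n i)%:R) *: iotaZ (A`_i) :> 'rV[rat]_d.
  rewrite /q iotaZB ec iotaZ_sum -sumrB; apply: eq_bigr => i _.
  by rewrite scalerBl pmulrn iotaZMz.
have qB j : - B%:Z <= q 0 j <= B%:Z.
  rewrite -ler_norml.
  rewrite -(ler_int rat) intr_norm.
  have -> : (q 0 j)%:~R = iotaZ q 0 j :> rat by rewrite [RHS]mxE.
  rewrite qE summxE (le_trans (ler_norm_sum _ _ _)) //.
  rewrite /B -[(_%:Z)%:~R]/(_%:R) natr_sum; apply: ler_sum => i _.
  have /andP [h0 h1] := cn i.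
  rewrite !mxE normrM (ger0_norm h0) (le_trans (ler_piMl _ h1)) // -intr_norm.
  rewrite (bigD1 j) //= natrD -[(absz _)%:R]/((absz _)%:Z%:~R) abszE lerDl ler0n //.
have [g gE] : exists g, r g = q.
  have lt j : (absz (q 0%R j + B%:Z)%R < (B + B).+1)%N by have := qB j; move: (q 0 j) => y; clear -y; move: B => N; clear; lia.
  exists [ffun j => Ordinal (lt j)]; apply/rowP => j; rewrite mxE ffunE /=.
  by have := qB j; move: (q 0 j) => y; clear -y; move: B => N; clear; lia.
have -> : m = q + \sum_(i < size A) A`_i *+ n i by rewrite subrK.
rewrite (bigD1 g) //= addrACA; apply: inNAD.
  by rewrite -gE; exact: (hw g).2.
apply: inNAD; first by apply: inNA_sum => i; apply/inNAMn/inNA_mem/mem_nth.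
rewrite -big_filter; apply: inNA_sum => h; exact: (hw h).1.
Qed.

(** Rank is preserved from the rationals to [K], so the generators on the facet span the whole
    kernel of [F]. *)
Lemma facet_ker (K : numFieldType) d (A : seq (Zd d)) F : facet_form A F ->
  exists2 s : seq (Zd d), (forall a, a \in s -> a \in A /\ evZ F a = 0) &
    forall y : 'rV[K]_d, dot (iotaZ F) y = 0 ->
      (y <= \matrix_(i < size s) iotaZ (s`_i))%MS.
Proof.
move=> [_ F1 [s [hs rs]]]; exists s => // y Fy.
set M : 'M[K]_(size s, d) := \matrix_(i < _) _.
have F0 : (iotaZ F : 'rV[K]_d) != 0.
  have [m Fm] := F1 1; apply/eqP => F0; have := dot_iotaZ K F m.
  by rewrite F0 dot0l -evZ_dot Fm => /eqP; rewrite eq_sym oner_eq0.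
have rM : \rank M = d.-1.
  rewrite -rs -(mxrank_map (@ratr K)); congr (\rank _).
  by rewrite /toQ; apply/matrixP => i j; rewrite !mxE /= ?mxE ratr_int.
have sub : (M <= kermx (iotaZ F : 'rV[K]_d)^T)%MS.
  rewrite sub_kermx; apply/eqP/row_matrixP => i; rewrite row_mul row0 rowK dot_mx dot_iotaZ.
  by have [_] := hs _ (mem_nth 0 (ltn_ord i)); rewrite evZ_dot => ->; rewrite mulr0z raddf0.
have := mxrank_leqif_eq sub => -[_].
rewrite rM mxrank_ker mxrank_tr rank_rV F0 subn1 eqxx => /esym /andP [_].
by apply: submx_trans; rewrite sub_kermx dot_mx Fy raddf0.
Qed.

(** [F'] vanishes on the kernel of [F], which is spanned by generators, so it is a multiple of [F];
    the factor is nonnegative and divides 1. *)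
Lemma facet_inj d (A : seq (Zd d)) (F F' : Zd d) : generates_group A ->
  facet_form A F -> facet_form A F' ->
  (forall a, a \in A -> evZ F a = 0 -> evZ F' a = 0) -> F' = F.
Proof.
move=> hA fF [F'0 F'1 _] sub.
have ker m : evZ F m = 0 -> evZ F' m = 0.
  move=> Fm; have [s hs hy] := @facet_ker rat _ _ _ fF.
  have /hy /submxP [D eD] : dot (iotaZ F) (iotaZ m : 'rV[rat]_d) = 0.
    by rewrite dot_iotaZ -evZ_dot Fm.
  apply/eqP; rewrite -(intr_eq0 rat) evZ_dot -dot_iotaZ eD mulmx_sum_row dot_sumr big1 // => i _.
  have [iA Fi] := hs _ (mem_nth 0 (ltn_ord i)).
  by rewrite dotZr rowK dot_iotaZ -evZ_dot (sub _ iA Fi) mulr0.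
have [F0 F1 _] := fF; have [x Fx] := F1 1.
have E m : evZ F' m = evZ F' x * evZ F m.
  have : evZ F (m - x *~ evZ F m) = 0 by rewrite evZ_dot dotBr -!evZ_dot evZMz Fx mul1r subrr.
  by move=> /ker; rewrite evZ_dot dotBr -!evZ_dot evZMz => /eqP; rewrite subr_eq0 => /eqP.
have [a aA] : exists2 a, a \in A & evZ F a != 0.
  have [|a aA] := @full_dot_neq0 rat _ _ (iotaZ F) hA.
    by apply/eqP => h; have := dot_iotaZ rat F x; rewrite h dot0l -evZ_dot Fx.
  by rewrite dot_iotaZ intr_eq0 -evZ_dot; exists a.
move=> Fa; have [x' Fx'] := F'1 1.
have c1 : evZ F' x = 1.
  have c0 : 0 <= evZ F' x.
    by have := F'0 _ aA; rewrite E pmulr_lge0 // lt_def Fa F0.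
  have : (evZ F' x %| 1)%Z by apply/dvdzP; exists (evZ F x'); rewrite mulrC -E Fx'.
  by rewrite dvdz1 => /eqP h; rewrite -(gez0_abs c0) h.
by apply/rowP => i; rewrite -!evZ_delta E c1 mul1r.
Qed.

(** A facet form is determined by which generators it kills, and there are finitely many such
    patterns. *)
Lemma facets_finite d (A : seq (Zd d)) : generates_group A ->
  exists Fs : seq (Zd d), forall F, facet_form A F <-> F \in Fs.
Proof.
move=> hA; pose z (F : Zd d) := [ffun i : 'I_(size A) => evZ F A`_i == 0].
have /choice [g hg] : forall mu, exists F,
    (exists F', facet_form A F' /\ z F' = mu) -> facet_form A F /\ z F = mu.
  move=> mu; have [[F [h e]]|h] := pselect (exists F', facet_form A F' /\ z F' = mu).
    by exists F.
  by exists 0.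
exists [seq F <- [seq g mu | mu <- enum {: {ffun 'I_(size A) -> bool}}] | `[< facet_form A F >]].
move=> F; rewrite mem_filter; split=> [fF|/andP [/asboolP]//].
rewrite asboolT //=; apply/mapP; exists (z F); first by rewrite mem_enum.
have [fG zG] := hg (z F) (ex_intro _ F (conj fF erefl)).
apply: (facet_inj hA fG fF) => a aA /eqP Ga.
have lt : (index a A < size A)%N by rewrite index_mem.
move/ffunP: zG => /(_ (Ordinal lt)); rewrite !ffunE /= nth_index // Ga.
by move=> /esym/eqP.
Qed.

Definition inNF d (A : seq (Zd d)) (F : Zd d) (z : int) := exists b, inNA A b /\ evZ F b = z.

Lemma evZD d (F a b : Zd d) : evZ F (a + b) = evZ F a + evZ F b.
Proof. exact: dotDr. Qed.

Lemma inNA_ge0 d (A : seq (Zd d)) F b : facet_form A F -> inNA A b -> 0 <= evZ F b.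
Proof.
move=> [F0 _ _] [k ->]; rewrite evZ_dot dot_sumr sumr_ge0 // => i _.
by rewrite pmulrn -evZ_dot evZMz mulr_ge0 // F0 // mem_nth.
Qed.

Lemma inNF_ge0 d (A : seq (Zd d)) F z : facet_form A F -> inNF A F z -> 0 <= z.
Proof. by move=> fF [b [hb <-]]; exact: inNA_ge0 hb. Qed.

(** [F] takes consecutive values [k] and [k + 1] on NA. For [k > 0] and [n >= k^2], write
    [n = q k + r = (q - r) k + r (k + 1)] with [r < k <= q]. *)
Lemma inNF_cofinite d (A : seq (Zd d)) F : generates_group A -> facet_form A F ->
  exists K : nat, forall z : int, K%:Z <= z -> inNF A F z.
Proof.
move=> hA fF; have [_ F1 _] := fF; have [x Fx] := F1 1.
have [u [w [hu hw e]]] := group_decomp hA x.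
have w0 := inNA_ge0 fF hw; have eu : evZ F u = evZ F w + 1.
  by rewrite -Fx e -evZD addrC subrK.
pose k := absz (evZ F w); have kE : evZ F w = k%:Z by rewrite gez0_abs.
exists (k * k)%N => z hz.
pose n := absz z; have nE : z = n%:Z by rewrite gez0_abs //; lia.
have hn : (k * k <= n)%N by rewrite nE in hz.
have [k0|k0] := posnP k.
  exists (u *+ n); split; first exact: inNAMn.
  by rewrite pmulrn evZMz eu kE k0 add0r mul1r.
exists (w *+ (n %/ k - n %% k) + u *+ (n %% k)); split.
  by apply: inNAD; exact: inNAMn.
have hq : (k <= n %/ k)%N by rewrite leq_divRL.
have hr : (n %% k < k)%N by rewrite ltn_mod.
rewrite evZD !pmulrn !evZMz eu kE nE -subzn; last by apply: leq_trans hq; exact: ltnW.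
by rewrite [in RHS](divn_eq n k) PoszD PoszM; ring.
Qed.

Lemma evC_dot d (F : Zd d) x : evC F x = dot (iotaZ F) x.
Proof. by apply: eq_bigr => i _; rewrite mxE. Qed.

Lemma evC_iotaZ d (F m : Zd d) : evC F (iotaZ m) = (evZ F m)%:~R.
Proof. by rewrite evC_dot dot_iotaZ. Qed.

Lemma evCD d (F : Zd d) x y : evC F (x + y) = evC F x + evC F y.
Proof. by rewrite !evC_dot dotDr. Qed.

Lemma in_Fplus_inNF d (A : seq (Zd d)) x F z :
  evC F x = z%:~R -> in_Fplus A x F <-> inNF A F z.
Proof.
move=> e; split=> [[b [hb]]|[b [hb ez]]]; last by exists b; rewrite e ez.
by rewrite e => /intr_inj ->; exists b.
Qed.

(* The weights of NA on the hyperplane [F = F x] move out of NA under [a], so the symbol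
   vanishes on them; they are Zariski dense in that hyperplane. *)
Lemma symL_facet_stable d (A : seq (Zd d)) (L : seq (Zd d * pfun d)) F x a :
  facet_form A F -> in_DRA A (opL L) -> in_Fplus A x F -> symL L a x != 0 ->
  in_Fplus A (x + iotaZ a) F.
Proof.
move=> fF hL [b [hb Fx]]; move=> sx; apply: contrapT => hn; move/eqP: sx; apply.
have [s hs hy] := @facet_ker CC _ _ _ fF.
have -> : x = iotaZ b + (x - iotaZ b) by rewrite subrKC.
apply: (polyfun_vanish_mx (s := s)
  (T := fun y => exists m, [/\ inNA A m, evZ F m = evZ F b & y = iotaZ m])).
- exact: polyfun_symL.
- move=> _ c [m [hm Fm ->]] /hs [cA Fc]; exists (m + c); split.
  + by apply: inNAD => //; exact: inNA_mem.
  + by rewrite evZD Fc addr0.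
  + by rewrite iotaZD.
- move=> _ [m [hm Fm ->]]; apply/eqP; apply: contraT => /(in_DRA_symL hL hm) hma.
  case: hn; exists (m + a); split=> //.
  by rewrite evCD Fx evC_iotaZ -Fm evZD intrD.
- by exists b.
by apply: hy; rewrite dotBr -evC_dot Fx dot_iotaZ -evZ_dot subrr.
Qed.

(** * Simplicity implies the conditions *)

Lemma simple_scored d (A : seq (Zd d)) : generates_group A -> DRA_simple A -> scored A.
Proof.
move=> hA simple m; split=> [hm F fF|hm]; first by exists m.
apply: contrapT => hnm; move: simple.
pose sc m := forall F, facet_form A F -> in_Fplus A (iotaZ m : 'rV[CC]_d) F.
have sc_m : sc m by move=> F /hm [b [hb Fb]]; exists b; rewrite evC_iotaZ Fb.
have [b hb cb] := conductor hA.
have sc_cb n : sc n -> inNA A (n + b).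
  move=> hn; apply: cb => F fF; have := hn F fF.
  by rewrite (in_Fplus_inNF _ (evC_iotaZ F n)); exact: inNF_ge0.
(* The weights are the points of the scored closure outside NA. Operators preserve both sets, so an
   intermediate weight stays in the closure, and it lies outside NA because the final one does. *)
apply: (@not_simple_of_weights _ _ (fun x => exists n, [/\ x = iotaZ n, sc n & ~ inNA A n])
  b (fun=> 1) hA).
- by exists (iotaZ m), m.
- move=> L M _ c e hL hM [n [-> scn nn]] [n' [en' scn' nn']] hMc hLe.
  exists (n + c); split; first by rewrite iotaZD.
    by move=> F fF; rewrite iotaZD; apply: (symL_facet_stable fF hM _ hMc); exact: scn.
  move=> hnc; have : inNA A (n + c + e) by apply: (in_DRA_symL hL hnc); rewrite iotaZD.
  suff -> : n + c + e = n' by [].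
  by apply/rowP => i; have /rowP/(_ i) := en'; rewrite !mxE -!rmorphD => /intr_inj.
- exact: polyfunC.
- by exists 0; exact: oner_neq0.
- apply: in_DRA_mon; first exact: polyfunC.
  by move=> n hn []; exact: inNAD.
(* The conductor element [b] sends every such weight into NA. *)
move=> _ [n [-> scn nn]] [n' [en' _ []]].
suff <- : n + b = n' by exact: sc_cb.
by apply/rowP => i; have /rowP/(_ i) := en'; rewrite !mxE -!rmorphD => /intr_inj.
Qed.

(** The forms whose strict positivity cuts out [R_{>0}(alpha)]. *)
Definition signed_form d (A : seq (Zd d)) (al : 'rV[CC]_d) (g : Zd d) : Prop :=
  exists2 F, facet_form A F & in_Fplus A al F /\ g = F \/ in_Fminus A al F /\ g = - F.

Lemma signed_forms_finite d (A : seq (Zd d)) al : generates_group A ->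
  exists G : seq (Zd d), forall g, g \in G <-> signed_form A al g.
Proof.
move=> hA; have [Fs hFs] := facets_finite hA.
exists ([seq F <- Fs | `[< in_Fplus A al F >]] ++
        [seq - F | F <- [seq F <- Fs | `[< in_Fminus A al F >]]]) => g.
rewrite mem_cat mem_filter; split.
  move=> /orP [/andP [/asboolP p /hFs fg]|/mapP [F]]; first by exists g => //; left.
  by rewrite mem_filter => /andP [/asboolP p /hFs fF] ->; exists F => //; right.
move=> [F /hFs fF [[/asboolP p ->]|[/asboolP p ->]]]; first by rewrite p fF.
by apply/orP; right; apply: map_f; rewrite mem_filter p fF.
Qed.

(** Gordan over the rationals, with denominators cleared in the first case. The relation is stated
    over every [K] because it is applied to real points and to complex weights. *)
Lemma gordanZ d (G : seq (Zd d)) :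
  (exists v : Zd d, forall g, g \in G -> 0 < evZ g v) \/
  (exists c : nat -> rat, [/\ forall i, 0 <= c i, \sum_(i < size G) c i = 1 &
     forall (K : numFieldType) (x : 'rV[K]_d),
       \sum_(i < size G) ratr (c i) * dot (iotaZ (G`_i)) x = 0]).
Proof.
have [[g hg]|[c [c0 c1 e]]] := gordan (map (@iotaZ rat d) G).
  left; have [N [v [N0 ev]]] := clear_denominators g; exists v => a aG.
  rewrite -(ltr0z rat) evZ_dot -dot_iotaZ ev dotZr mulr_gt0 ?ltr0n //.
  have := hg _ (map_f iotaZ aG); congr (0 < _).
  by apply: eq_bigr => i _; rewrite mulrC.
right; exists c; rewrite size_map in c1 e; split=> // K x.
transitivity (dot (\sum_(i < size G) ratr (c i) *: iotaZ (G`_i)) x).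
  by rewrite dot_suml; apply: eq_bigr => i _; rewrite dotZl.
suff -> : \sum_(i < size G) ratr (c i) *: iotaZ (G`_i) = 0 :> 'rV[K]_d by exact: dot0l.
apply/rowP => j; have /rowP/(_ j) := e; rewrite !mxE !summxE => /(congr1 (@ratr K)).
rewrite rmorph0 rmorph_sum => h; rewrite -[RHS]h; apply: eq_bigr => i _.
by rewrite (nth_map 0) // !mxE rmorphM /= ratr_int.
Qed.

(** The forms are integral: without a lattice point, Gordan gives a convex relation between them,
    which fails at a real point where all of them are positive. *)
Lemma Rpos_nonemptyP d (A : seq (Zd d)) al : generates_group A ->
  Rpos_nonempty A al <-> exists v : Zd d, forall g, signed_form A al g -> 0 < evZ g v.
Proof.
move=> hA; have evRE (F : Zd d) g : evR F g = dot (iotaZ F) g.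
  by apply: eq_bigr => i _; rewrite mxE.
split=> [[g hg]|[v hv]]; last first.
  exists (iotaZ v) => F fF; rewrite evRE dot_iotaZ ltr0z ltrz0; split=> h.
    by apply: hv; exists F => //; left.
  by rewrite -oppr_gt0 -dotNl; apply: hv; exists F => //; right.
have [G hG] := signed_forms_finite al hA.
have [[v hv]|[c [c0 c1 e]]] := gordanZ G; first by exists v => a /hG; exact: hv.
have pos i : (i < size G)%N -> 0 < dot (iotaZ (G`_i)) g.
  move=> lt; have /hG [F fF [[h ->]|[h ->]]] := mem_nth 0 lt.
    by rewrite -evRE; exact: (hg F fF).1.
  by rewrite iotaZN dotNl oppr_gt0 -evRE; exact: (hg F fF).2.
have /psumr_eq0P z := e RR g.
suff : \sum_(i < size G) c i = 0 by rewrite c1 => /eqP; rewrite oner_eq0.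
rewrite big1 // => i _.
have := z (fun i _ => mulr_ge0 (etrans (ler0q _ _) (c0 i)) (ltW (pos i (ltn_ord i)))) i isT.
move=> /eqP; rewrite mulf_eq0 (gt_eqF (pos i (ltn_ord i))) orbF fmorph_eq0 => /eqP //.
Qed.

Lemma facets_cofinite d (A : seq (Zd d)) : generates_group A ->
  exists K : nat, forall F, facet_form A F -> forall z : int, K%:Z <= z -> inNF A F z.
Proof.
move=> hA; have [Fs hFs] := facets_finite hA.
have /choice [k hk] : forall F, exists K : nat, facet_form A F ->
    forall z : int, K%:Z <= z -> inNF A F z.
  move=> F; have [fF|nF] := pselect (facet_form A F); last by exists 0%N.
  by have [K hK] := inNF_cofinite hA fF; exists K.
exists (\sum_(F <- Fs) k F)%N => F fF z hz; apply: hk => //.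
have /hFs FFs := fF; apply: le_trans hz.
by rewrite (big_rem F) //= lez_nat leq_addr.
Qed.

Lemma simple_Rpos d (A : seq (Zd d)) (al : 'rV[CC]_d) :
  generates_group A -> DRA_simple A -> Rpos_nonempty A al.
Proof.
move=> hA simple; apply: contrapT => nR; move: simple.
have [G hG] := signed_forms_finite al hA.
have [[v hv]|[c [c0 c1 e]]] := gordanZ G.
  by case: nR; apply/(Rpos_nonemptyP _ hA); exists v => g /hG; exact: hv.
pose B x := (exists m, x = al + iotaZ m) /\
  forall F, facet_form A F -> in_Fplus A al F <-> in_Fplus A x F.
have [K hK] := facets_cofinite hA.
(* Values in [F(NA)] are nonnegative, and integers outside it are less than [K]. *)
have low x g : B x -> g \in G -> exists z : int, evC g x = z%:~R /\ - K%:Z <= z.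
  move=> [[m ex] Bx] /hG [F fF [[hF ->]|[[[z ez] hF] ->]]].
    have /(Bx F fF) [b [hb Fb]] := hF; exists (evZ F b); split=> //.
    by have := inNA_ge0 fF hb; lia.
  have Fx : evC F x = (z + evZ F m)%:~R by rewrite ex evCD ez evC_iotaZ intrD.
  exists (- (z + evZ F m)); split.
    by rewrite intrN -Fx !evC_dot iotaZN dotNl.
  rewrite lerN2 leNgt; apply/negP => /ltW /(hK F fF) h.
  by apply/hF/(Bx F fF)/(in_Fplus_inNF _ Fx).
have [j cj] : exists j : 'I_(size G), 0 < c j.
  apply: contrapT => h; have : \sum_(i < size G) c i = 0.
    rewrite big1 // => i _; apply/eqP; rewrite eq_le c0 andbT leNgt; apply/negP => ci.
    by apply: h; exists i.
  by rewrite c1 => /eqP; rewrite oner_eq0.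
(* In the relation all values are at least [-K] and the coefficients sum to 1, so the [j]-th value
   is at most [K / c j], which is less than [M]. *)
pose M := (Num.trunc (K%:R / c j)).+1.
have up x z : B x -> evC G`_j x = z%:~R -> z < M%:Z.
  move=> Bx ez.
  have /choice [y hy] : forall i : 'I_(size G), exists z : int,
      evC G`_i x = z%:~R /\ - K%:Z <= z.
    by move=> i; apply: low => //; exact: mem_nth.
  have yz : y j = z by apply: (@intr_inj CC); rewrite -ez (hy j).1.
  have s0 : \sum_(i < size G) c i * (y i)%:~R = 0.
    apply: (fmorph_inj (@ratr CC)); rewrite rmorph0 rmorph_sum -[RHS](e CC x).
    by apply: eq_bigr => i _; rewrite rmorphM /= ratr_int -evC_dot (hy i).1.
  have : c j * z%:~R <= K%:R.
    move/eqP: s0; rewrite (bigD1 j) //= yz addr_eq0 => /eqP ->.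
    rewrite -sumrN (@le_trans _ _ (\sum_(i < size G | i != j) c i * K%:R)) //.
      apply: ler_sum => i _; rewrite -mulrN ler_wpM2l // -intrN.
      by rewrite -[K%:R]/(K%:Z%:~R) ler_int lerNl (hy i).2.
    rewrite -mulr_suml ler_piMl ?ler0n // -c1 [leRHS](bigD1 j) //= lerDr; exact: c0.
  rewrite mulrC -ler_pdivlMr // => h; rewrite -(ltr_int rat).
  apply: le_lt_trans h _; rewrite -[M%:~R]/(M%:R).
  by have /andP [] := truncn_itv (divr_ge0 (ler0n rat K) (c0 j)).
(* [B] lies on the [K + M] hyperplanes where the [j]-th form takes a value from [-K] to [M - 1]. *)
pose p (x : 'rV[CC]_d) : CC := \prod_(k < K + M) (evC G`_j x - (k%:Z - K%:Z)%:~R).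
have hp : polyfun p.
  apply: polyfun_prod => k; apply: polyfunB; last exact: polyfunC.
  by apply: polyfun_sum => i; apply: polyfunZ; exact: polyfunX.
apply: (@not_simple_of_weights _ _ B 0 p hA) => //.
- by exists al; split=> //; exists 0; rewrite iotaZ0 addr0.
- move=> L N x b f hL hN [[m ex] Bx] [_ Bf] hb hf; split.
    by exists (m + b); rewrite ex -addrA iotaZD.
  move=> F fF; split=> h.
    by apply: (symL_facet_stable fF hN _ hb); apply/(Bx F fF).
  by apply/(Bf F fF); exact: (symL_facet_stable fF hL _ hf).
(* The value [M] lies just beyond these roots. *)
- have [v hv] : exists v, evZ G`_j v = M%:Z.
    have /hG [F [_ F1 _] [[_ ->]|[_ ->]]] := mem_nth 0 (ltn_ord j); first exact: F1.
    by have [v hv] := F1 (- M%:Z); exists v; rewrite evZ_dot dotNl -evZ_dot hv opprK.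
  exists (iotaZ v); apply/prodf_neq0 => k _.
  rewrite evC_iotaZ hv -intrB intr_eq0; have := ltn_ord k; lia.
- by apply: in_DRA_mon => // m hm []; rewrite addr0.
move=> x Bx _; have [z [ez hz]] := low x _ Bx (mem_nth 0 (ltn_ord j)).
have hzM := up x z Bx ez.
have lt : (absz (z + K%:Z)%R < K + M)%N by lia.
apply/eqP/prodf_eq0; exists (Ordinal lt) => //.
rewrite ez -intrB intr_eq0 /=; lia.
Qed.

(** * Products of affine forms and ideals of D(R_A) *)

(** An affine form is encoded by its coefficient vector, constant term first, so that linear algebra
    applies to spaces of affine forms. *)
Definition aff d (w : 'rV[CC]_(1 + d)) (x : 'rV[CC]_d) : CC := dot w (row_mx 1%:M x).

Lemma polyfun_aff d (w : 'rV[CC]_(1 + d)) : polyfun (aff w).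
Proof.
apply: polyfun_sum => k; apply: polyfunZ; rewrite -[k]splitK; case: (split k) => j /=.
  by apply: polyfun_ext (polyfunC _ ((1%:M : 'M[CC]_1) 0 j)) => x; rewrite row_mxEl.
by apply: polyfun_ext (polyfunX _ j) => x; rewrite row_mxEr.
Qed.

Definition prodaff d (W : seq 'rV[CC]_(1 + d)) (x : 'rV[CC]_d) : CC := \prod_(w <- W) aff w x.

Lemma polyfun_prodaff d (W : seq 'rV[CC]_(1 + d)) : polyfun (prodaff W).
Proof. by apply: polyfun_prod => w; exact: polyfun_aff. Qed.

Definition poly_ideal d (J : ('rV[CC]_d -> CC) -> Prop) : Prop :=
  [/\ J (fun=> 0), (forall p q, J p -> J q -> J (fun x => p x + q x)) &
      (forall p q, polyfun p -> J q -> J (fun x => p x * q x))].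

(** The ideal [J + (g)]. *)
Definition ideal_adjoin d (J : ('rV[CC]_d -> CC) -> Prop) (g p : 'rV[CC]_d -> CC) : Prop :=
  exists q r, [/\ J q, polyfun r & p = fun x => q x + r x * g x].

Lemma poly_ideal_adjoin d (J : ('rV[CC]_d -> CC) -> Prop) g :
  poly_ideal J -> poly_ideal (ideal_adjoin J g).
Proof.
move=> [J0 JD JM]; split.
- exists (fun=> 0), (fun=> 0); split=> //; first exact: polyfunC.
  by apply/funext => x; rewrite mul0r addr0.
- move=> _ _ [q [r [Jq hr ->]]] [q' [r' [Jq' hr' ->]]].
  exists (fun x => q x + q' x), (fun x => r x + r' x); split; [exact: JD|exact: polyfunD|].
  by apply/funext => x; ring.
move=> p _ hp [q [r [Jq hr ->]]].
exists (fun x => p x * q x), (fun x => p x * r x); split; [exact: JM|exact: polyfunM|].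
by apply/funext => x; ring.
Qed.

Lemma sub_ideal_adjoin d (J : ('rV[CC]_d -> CC) -> Prop) g p : J p -> ideal_adjoin J g p.
Proof.
move=> Jp; exists p, (fun=> 0); split=> //; first exact: polyfunC.
by apply/funext => x; rewrite mul0r addr0.
Qed.

(** Modulo [J] every factor is a unit, so the product is one too. *)
Lemma adjoin_prod_unit d (J : ('rV[CC]_d -> CC) -> Prop) (W : seq 'rV[CC]_(1 + d)) :
  poly_ideal J -> (forall w, w \in W -> ideal_adjoin J (aff w) (fun=> 1)) ->
  ideal_adjoin J (prodaff W) (fun=> 1).
Proof.
move=> [J0 JD JM]; elim: W => [|w W IH] hW.
  exists (fun=> 0), (fun=> 1); split=> //; first exact: polyfunC.
  by apply/funext => x; rewrite /prodaff big_nil mulr1 add0r.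
have [|q [r [Jq hr e]]] := hW w; first by rewrite inE eqxx.
have [|q' [r' [Jq' hr' e']]] := IH; first by move=> v vW; apply: hW; rewrite inE vW orbT.
exists (fun x => q x + (r x * aff w x) * q' x), (fun x => r x * r' x); split.
- by apply: JD => //; apply: JM => //; apply: polyfunM => //; exact: polyfun_aff.
- exact: polyfunM.
apply/funext => x.
have e1 : 1 = q x + r x * aff w x := congr1 (fun f => f x) e.
have e2 : 1 = q' x + r' x * prodaff W x := congr1 (fun f => f x) e'.
rewrite [LHS]e1 -[aff w x in LHS]mulr1 e2 /prodaff big_cons; ring.
Qed.

(* While the affine forms in the ideal have a common zero, some product in the ideal does
   not vanish there, and adjoining any one of its factors raises the rank of that space
   of affine forms. *)
Lemma affine_nullstellensatz d m (J : ('rV[CC]_d -> CC) -> Prop) (M : 'M[CC]_(m, 1 + d)) :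
  poly_ideal J ->
  (forall w, (w <= M)%MS -> J (aff w)) ->
  (forall al, exists2 W, J (prodaff W) & forall w, w \in W -> aff w al != 0) ->
  J (fun=> 1).
Proof.
have [n] := ubnP (1 + d - \rank M); elim: n m J M => // n IH m J M.
rewrite ltnS => hn idJ hM hz; pose e : 'rV[CC]_(1 + d) := row_mx 1%:M 0.
have [eM|neM] := boolP (e <= M)%MS.
  have := hM _ eM; congr J; apply/funext => x.
  by rewrite /aff dot_row_mx dot0l addr0 /dot big_ord1 !mxE mulr1.
(* [y] kills [M] and its constant coordinate is nonzero; rescaling that coordinate to 1 gives a
   common zero [al] of the forms in [M]. *)
have [y ye hy] := separating_form neM.
set t := dot y e in ye.
pose al := t^-1 *: rsubmx y.
have alE w : aff w al = t^-1 * dot y w.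
  rewrite /aff -dotZl [RHS](_ : _ = dot w (t^-1 *: y)); last by apply: eq_bigr => i _; exact: mulrC.
  congr dot; rewrite -[y in RHS]hsubmxK scale_row_mx; congr row_mx.
  have tE : t = lsubmx y 0 0.
    by rewrite /t /e -[y in LHS]hsubmxK dot_row_mx dot0r addr0 /dot big_ord1 [X in _ * X]mxE mulr1.
  by apply/rowP => i; rewrite ord1 [RHS]mxE -tE mulVf // mxE.
have [W JW hW] := hz al.
have [q [r [Jq hr e1]]] : ideal_adjoin J (prodaff W) (fun=> 1).
  apply: adjoin_prod_unit => // w wW.
  apply: (IH _ _ (col_mx M w)); last 1 first.
  - by move=> be; have [V JV hV] := hz be; exists V => //; exact: sub_ideal_adjoin.
  - apply: leq_trans hn; apply: ltn_sub2l.
      by rewrite ltn_neqAle rank_leq_col andbT; apply: contra neM => f; rewrite submx_full.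
    suff : (M < col_mx M w)%MS by rewrite ltmxErank => /andP [].
    rewrite ltmxE -!addsmxE addsmxSl; apply: contra (hW w wW) => h.
    by rewrite alE hy ?mulr0 //; apply: submx_trans h; exact: addsmxSr.
  - exact: poly_ideal_adjoin.
  move=> v; rewrite -addsmxE => /sub_addsmxP [[D1 D2] /= ->].
  exists (aff (D1 *m M)), (fun=> D2 0 0); split; [|exact: polyfunC|].
    by apply: hM; exact: submxMl.
  apply/funext => x; rewrite /aff dotDl; congr (_ + _).
  by rewrite [D2]mx11_scalar mul_scalar_mx dotZl mxE eqxx mulr1n.
have [_ JD JM] := idJ.
by have := JD _ _ Jq (JM _ _ hr JW); rewrite -e1.
Qed.

Lemma ideal_opD d (A : seq (Zd d)) I P Q : two_sided_ideal A I -> I P -> I Q ->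
  I (fun f n => P f n + Q f n).
Proof.
move=> [_ I0 IB _] IP IQ; have := IB _ _ IP (IB _ _ I0 IQ); congr I.
by apply/funext => f; apply/funext => n; rewrite /opB /op0 sub0r opprK.
Qed.

Lemma in_DRA_theta d (A : seq (Zd d)) p : polyfun p -> in_DRA A (mon 0 p).
Proof. by move=> hp; apply: in_DRA_mon => // m hm []; rewrite addr0. Qed.

(* Commutators with the Euler operators separate the homogeneous components. *)
Lemma ideal_homogeneous d (A : seq (Zd d)) I (U : seq (Zd d)) (S : Zd d -> pfun d) P :
  two_sided_ideal A I -> uniq U -> I P -> P = (fun f n => \sum_(a <- U) mon a (S a) f n) ->
  (exists2 a, a \in U & exists x, S a x != 0) ->
  exists a p, [/\ polyfun p, exists x, p x != 0 & I (mon a p)].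
Proof.
move=> hI; have [_ _ IB IM] := hI.
elim: U S P => [|a0 U IH] S P; first by move=> _ _ _ [].
move=> /= /andP [a0U uU] IP eP [a aU Sa].
have [[a1 a1U [x1 Sa1]]|no] := pselect (exists2 a, a \in U & exists x, S a x != 0).
  have [i ai] : exists i, a1 0 i != a0 0 i.
    apply/existsP; apply: contraNT a0U => /existsPn h.
    suff -> : a0 = a1 by []; apply/rowP => i; apply/eqP; rewrite eq_sym.
    by move: (h i); rewrite negbK.
  pose th := mon (0 : Zd d) (fun x : 'rV[CC]_d => x 0 i).
  pose cc := mon (0 : Zd d) (fun _ : 'rV[CC]_d => (a0 0 i)%:~R).
  have Dth : in_DRA A th by apply: in_DRA_theta; exact: polyfunX.
  have Dcc : in_DRA A cc by apply: in_DRA_theta; exact: polyfunC.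
  (* [[theta_i, P] - a0_i P] multiplies the component of degree [b] by [b_i - a0_i]: it kills degree
     [a0] and keeps [a1]. *)
  have IP' := IB _ _ (IB _ _ (IM _ _ Dth IP).1 (IM _ _ Dth IP).2) (IM _ _ Dcc IP).1.
  pose S' (b : Zd d) := PFun (polyfunZ (b 0 i - a0 0 i)%:~R (pfunP (S b))).
  apply: (IH S' _ uU IP').
    apply/funext => f; apply/funext => n; rewrite /opB /opM eP /th /cc /mon subr0.
    rewrite !mulr_sumr -!sumrB big_cons [X in X + _](_ : _ = 0) ?add0r; last first.
      by rewrite subr0 !mxE !intrB; ring.
    by apply: eq_bigr => b _; rewrite /= subr0 !mxE !intrB; ring.
  exists a1 => //; exists x1; rewrite /= mulf_neq0 // intr_eq0 subr_eq0 //.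
exists a0, (S a0); split; first exact: pfunP.
  move: aU; rewrite inE => /predU1P [<- //|aU]; by case: no; exists a.
have := IP; congr I; rewrite eP; apply/funext => f; apply/funext => n.
rewrite big_cons big_seq big1 ?addr0 // => b bU.
rewrite /mon; suff -> : S b (iotaZ (n - b)) = 0 by rewrite mul0r.
apply: contrapT => /eqP h; apply: no; exists b => //.
by exists (iotaZ (n - b)).
Qed.

Lemma inNA_ind d (A : seq (Zd d)) (Q : Zd d -> Prop) : Q 0 ->
  (forall a b, Q a -> Q b -> Q (a + b)) -> (forall a, a \in A -> Q a) ->
  forall m, inNA A m -> Q m.
Proof.
move=> Q0 QD QA _ [k ->]; apply: (big_rec Q) => // i m _ Qm; apply: (QD) => //.
elim: (k i) => [|n IH]; first by rewrite mulr0n.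
by rewrite mulrS; apply: QD => //; apply: QA; exact: mem_nth.
Qed.

Lemma in_DRA_mono d (A : seq (Zd d)) v : inNA A v -> in_DRA A (mon v (fun=> 1)).
Proof.
by move=> hv; apply: in_DRA_mon => [|m hm []]; [exact: polyfunC|exact: inNAD].
Qed.

Lemma shift_invariant_const (K : numFieldType) d (A : seq (Zd d)) (p : 'rV[K]_d -> K) :
  generates_group A -> polyfun p -> (forall v x, v \in A -> p (x + iotaZ v) = p x) ->
  forall x, p x = p 0.
Proof.
move=> hA hp inv x; apply/eqP; rewrite -subr_eq0; apply/eqP.
move: x; apply: (polyfun_NA_zero (x0 := 0) hA).
  by apply: polyfunB => //; exact: polyfunC.
move=> m hm; suff H : forall x, p (x + iotaZ m) = p x by rewrite H subrr.
move: m hm; apply: inNA_ind => [x|a b ha hb x|a aA x]; last exact: inv.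
  by rewrite iotaZ0 addr0.
by rewrite iotaZD addrA hb ha.
Qed.

(* Commutators with the monomials of R_A act on symbols as difference operators. *)
Lemma ideal_monomial d (A : seq (Zd d)) I n a p : generates_group A -> two_sided_ideal A I ->
  pdeg n p -> (exists x, p x != 0) -> I (mon a p) -> exists b, I (mon b (fun=> 1)).
Proof.
move=> hA hI; have [_ _ IB IM] := hI.
(* When all differences vanish, [p0] is a nonzero constant and can be divided out. *)
have const a0 (p0 : 'rV[CC]_d -> CC) : polyfun p0 -> (exists x, p0 x != 0) -> I (mon a0 p0) ->
    ~ (exists v, v \in A /\ exists x, p0 (x + iotaZ v) - p0 x != 0) ->
    exists b, I (mon b (fun=> 1)).
  move=> hp0 [x0 px0] Ip0 no; exists a0.
  have E : forall x, p0 x = p0 0.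
    apply: (shift_invariant_const hA hp0) => v x vA.
    apply/eqP; rewrite -subr_eq0; apply: contrapT => /negP h; apply: no.
    by exists v; split=> //; exists x.
  have Dc : in_DRA A (mon 0 (fun=> (p0 0)^-1)) by apply: in_DRA_theta; exact: polyfunC.
  have := (IM _ _ Dc Ip0).1; rewrite opM_mon add0r; congr (I (mon _ _)).
  by apply/funext => x; rewrite E mulVf // -(E x0).
elim: n a p => [|n IH] a p hp hp0 Ip;
  have [[v [vA [x hx]]]|no] :=
    pselect (exists v, v \in A /\ exists x, p (x + iotaZ v) - p x != 0).
- by move: hx; have /= -> := pdeg_diff (iotaZ v) hp; rewrite eqxx.
- by apply: (const a p) => //; exists 0%N.
- have Dv := in_DRA_mono (inNA_mem vA).
  (* [[t^a p(theta), t^v] = t^(a + v) (p(theta + v) - p(theta))]. *)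
  have IP' := IB _ _ (IM _ _ Dv Ip).2 (IM _ _ Dv Ip).1.
  apply: (IH (a + v) (fun x => p (x + iotaZ v) - p x)).
  + exact: (pdeg_diff (iotaZ v) hp).
  + by exists x.
  have := IP'; congr I; rewrite !opM_mon; apply/funext => f; apply/funext => k.
  by rewrite /opB /mon [v + a]addrC mulr1 mul1r mulrBl.
- by apply: (const a p) => //; exists n.+1.
Qed.

(** * The conditions imply simplicity *)

(** When NA is scored, an element leaves it under [a] only through some facet [F], from a value [k]
    in [F(NA)] with [k + F(a)] outside. The product of the forms [F - k] over all such lost pairs
    kills these elements, and a factor vanishes at [x] only if [x] itself loses [F]. *)
Lemma scored_symbol d (A : seq (Zd d)) a : generates_group A -> scored A ->
  exists W : seq 'rV[CC]_(1 + d), in_DRA A (mon a (prodaff W)) /\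
    forall x, (forall F, facet_form A F -> in_Fplus A x F -> in_Fplus A (x + iotaZ a) F) ->
      forall w, w \in W -> aff w x != 0.
Proof.
move=> hA hs; have [Fs hFs] := facets_finite hA; have [K hK] := facets_cofinite hA.
pose form (F : Zd d) (k : nat) : 'rV[CC]_(1 + d) := row_mx (- k%:R)%:M (iotaZ F).
have formE F k x : aff (form F k) x = evC F x - k%:R.
  by rewrite /aff dot_row_mx evC_dot addrC /dot big_ord1 !mxE !eqxx !mulr1n mulr1.
pose lost F (k : nat) := inNF A F k%:Z /\ ~ inNF A F (k%:Z + evZ F a).
(* No value from [K + |F(a)|] on is lost, so finitely many factors suffice. *)
pose W := [seq form F k | F <- Fs,
  k <- [seq k <- iota 0 (K + absz (evZ F a)) | `[< lost F k >]]].
exists W; split.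
  apply: in_DRA_mon; first exact: polyfun_prodaff.
  move=> m hm hma; apply/eqP.
  have [F fF hF] : exists2 F, facet_form A F & ~ inNF A F (evZ F (m + a)).
    apply: contrapT => h; apply: hma; apply/hs => F fF.
    by apply: contrapT => hF; apply: h; exists F.
  have F0 := inNA_ge0 fF hm; have kE := gez0_abs F0; set k := absz _ in kE.
  have inW : form F k \in W.
    apply/allpairsPdep; exists F, k; split=> //; first by apply/hFs.
    rewrite mem_filter mem_iota; apply/andP; split.
      by apply/asboolP; split; rewrite kE -?evZD //; exists m.
    rewrite leq0n add0n ltnNge; apply/negP => hk; apply: hF; apply: (hK F fF).
    by rewrite evZD -kE; lia.
  rewrite prodf_seq_eq0; apply/hasP; exists (form F k) => //=.
  by rewrite formE evC_iotaZ -kE subrr.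
move=> x hx w /allpairsPdep [F [k [/hFs fF]]].
rewrite mem_filter => /andP [/asboolP [h1 h2] _] ->; rewrite formE subr_eq0.
apply/eqP => e; apply: h2; have e' : evC F (x + iotaZ a) = (k%:Z + evZ F a)%:~R by rewrite evCD e evC_iotaZ intrD.
apply/(in_Fplus_inNF _ e')/hx => //.
exact: ((in_Fplus_inNF A (e : evC F x = k%:Z%:~R)).2 h1).
Qed.

Definition shift_aff d (v : 'rV[CC]_d) (w : 'rV[CC]_(1 + d)) : 'rV[CC]_(1 + d) :=
  w + row_mx (dot (rsubmx w) v)%:M 0.

Lemma aff_shift d v (w : 'rV[CC]_(1 + d)) x : aff (shift_aff v w) x = aff w (x + v).
Proof.
rewrite /aff /shift_aff dotDl -[w]hsubmxK !dot_row_mx row_mxKr dot0l addr0 dotDr addrA.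
by congr (_ + _); rewrite /dot big_ord1 !mxE eqxx mulr1n mulr1.
Qed.

(** Take a large multiple of a lattice point of [R_{>0}(alpha)]: on [F_+] the values pass the
    threshold [K], on [F_-] they become negative even after adding [b], and non-integral values stay
    non-integral. *)
Lemma deep_translate d (A : seq (Zd d)) al b : generates_group A -> Rpos_nonempty A al ->
  exists v : Zd d, forall F, facet_form A F ->
    (in_Fplus A al F -> in_Fplus A (al + iotaZ v) F) /\
    (in_Fplus A (al + iotaZ (b + v)) F -> in_Fplus A al F).
Proof.
move=> hA /(Rpos_nonemptyP _ hA) [v0 hv0].
have [Fs hFs] := facets_finite hA; have [K hK] := facets_cofinite hA.
have /choice [N hN] : forall F, exists N : nat, facet_form A F -> forall n, (N <= n)%N ->
    (in_Fplus A al F -> in_Fplus A (al + iotaZ (v0 *~ n%:Z)) F) /\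
    (in_Fplus A (al + iotaZ (b + v0 *~ n%:Z)) F -> in_Fplus A al F).
  move=> F; have [fF|nF] := pselect (facet_form A F); last by exists 0%N.
  have [hF|hF] := pselect (in_Fplus A al F).
    exists K => _ n Kn; split=> // _; have [c [hc ec]] := hF.
    have pos : 0 < evZ F v0 by apply: hv0; exists F => //; left.
    have e : evC F (al + iotaZ (v0 *~ n%:Z)) = (evZ F c + evZ F v0 * n%:Z)%:~R.
      by rewrite evCD ec evC_iotaZ evZMz intrD.
    apply/(in_Fplus_inNF _ e)/(hK F fF).
    by have := inNA_ge0 fF hc; nia.
  have [[z ez]|nz] := pselect (exists z : int, evC F al = z%:~R).
    have pos : 0 < evZ (- F) v0 by apply: hv0; exists F => //; right; split=> //; split; first by exists z.
    rewrite evZ_dot dotNl -evZ_dot oppr_gt0 in pos.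
    exists (absz (z + evZ F b)).+1 => _ n hn; split=> // hplus; exfalso.
    have e : evC F (al + iotaZ (b + v0 *~ n%:Z)) = (z + (evZ F b + evZ F v0 * n%:Z))%:~R.
      by rewrite evCD ez evC_iotaZ evZD evZMz -intrD.
    have := inNF_ge0 fF ((in_Fplus_inNF _ e).1 hplus); rewrite addrA.
    by move: hn pos; move: (z + _) (evZ F v0) => y u; nia.
  exists 0%N => _ n _; split=> // -[c [_]]; rewrite evCD evC_iotaZ => ec; exfalso.
  by apply: nz; exists (evZ F c - evZ F (b + v0 *~ n%:Z)); rewrite intrB -ec addrK.
exists (v0 *~ (\sum_(F <- Fs) N F)%N%:Z) => F fF; apply: hN => //.
by have /hFs FFs := fF; rewrite (big_rem F) //= leq_addr.
Qed.

Lemma scored_simple d (A : seq (Zd d)) : generates_group A -> scored A ->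
  (forall al : 'rV[CC]_d, Rpos_nonempty A al) -> DRA_simple A.
Proof.
move=> hA hs hR I hI; have [ID I0 IB IM] := hI.
have [[P [IP P0]]|no] := pselect (exists P, I P /\ P <> @op0 d); last first.
  left=> P; split=> [IP|-> //]; apply: contrapT => P0; apply: no.
  by exists P.
right=> Q; split=> [/ID //|DQ].
suff I1 : I (mon 0 (fun=> 1)).
  have := (IM _ _ DQ I1).1; congr I; rewrite /opM.
  apply/funext => f; congr Q; apply/funext => n.
  by rewrite /mon mul1r subr0.
have [wP _] := ID _ IP; have [L eL] := weyl_opL wP.
have [a [p [[n hp] hp0 Ip]]] : exists a p, [/\ polyfun p, exists x, p x != 0 & I (mon a p)].
  pose S a := PFun (polyfun_symL L a).
  have eP : P = (fun f n => \sum_(a <- undup (unzip1 L)) mon a (S a) f n).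
    by rewrite eL; apply/funext => f; apply/funext => n; exact: opL_symL.
  apply: (ideal_homogeneous (S := S) hI (undup_uniq _) IP eP).
  apply: contrapT => h; apply: P0; rewrite eP; apply/funext => f; apply/funext => n.
  rewrite big_seq big1 // => b bU; rewrite /mon; suff -> : S b (iotaZ (n - b)) = 0 by rewrite mul0r.
  by apply: contrapT => /eqP hb; apply: h; exists b => //; exists (iotaZ (n - b)).
have [b Ib] := ideal_monomial hA hI hp hp0 Ip.
(* The degree 0 part of [I], as an ideal of polynomials. *)
pose J p := polyfun p /\ I (mon 0 p).
suff [] : J (fun=> 1) by [].
apply: (@affine_nullstellensatz _ _ J (0 : 'M_(1 + d))).
- split.
  + split; first exact: polyfunC.
    have := I0; congr I; apply/funext => f; apply/funext => k.
    by rewrite /mon mul0r.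
  + move=> q r [hq Iq] [hr Ir]; split; first exact: polyfunD.
    have := ideal_opD hI Iq Ir; congr I; apply/funext => f; apply/funext => k.
    by rewrite /mon mulrDl.
  move=> q r hq [hr Ir]; split; first exact: polyfunM.
  have := (IM _ _ (in_DRA_theta A hq) Ir).1; rewrite opM_mon addr0; congr (I (mon _ _)).
  by apply/funext => x; rewrite iotaZ0 addr0.
- move=> w; rewrite submx0 => /eqP ->; split; first exact: polyfun_aff.
  have := I0; congr I; apply/funext => f; apply/funext => k.
  by rewrite /mon /aff dot0l mul0r.
move=> al; have [v hv] := deep_translate b hA (hR al).
have [W1 [D1 n1]] := scored_symbol v hA hs.
have [W2 [D2 n2]] := scored_symbol (- (b + v)) hA hs.
(* The factors of the symbol of [t^(-(b+v)) p_{-(b+v)}(theta) t^b t^v p_v(theta)], which leads from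
   [al] to [al + b + v] and back. *)
exists (map (shift_aff (iotaZ (b + v))) W2 ++ W1).
  split; first exact: polyfun_prodaff.
  have := (IM _ _ D2 (IM _ _ D1 Ib).2).1; rewrite !opM_mon addNr; congr (I (mon _ _)).
  apply/funext => x; rewrite mul1r /prodaff big_cat big_map /=; congr (_ * _).
  by apply: eq_bigr => w _; rewrite aff_shift.
(* The way back ends at [al] and the way out starts there; by the choice of [v], neither loses a
   facet of [F_+]. *)
move=> w; rewrite mem_cat => /orP [/mapP [w2 w2W ->]|w1W].
  rewrite aff_shift; apply: n2 w2W => F fF hF.
  by rewrite -addrA -iotaZD subrr iotaZ0 addr0; exact: (hv F fF).2.
by apply: n1 w1W => F fF; exact: (hv F fF).1.
Qed.

Theorem theorem8p24 (d : nat) (A : seq (Zd d)) (hA : generates_group A) :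
  DRA_simple A <-> (scored A /\ forall al : 'rV[CC]_d, Rpos_nonempty A al).
Proof.
split=> [simple|[hs hR]]; last exact: scored_simple.
split; first exact: simple_scored.
by move=> al; exact: simple_Rpos.
Qed.
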